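(* Let $\mathcal{P}$ be a fixed hyper-prior and $\delta>0$. Then with probability at least $1-\delta$ over the sampling of $S_1,\dots,S_n$, simultaneously for all hyper-posteriors $\mathcal{Q}$ and all posteriors $Q_1,\dots,Q_n$, $$\mathrm{kl}\big(\widehat{\mathcal{R}}^{S}\,\big|\,\mathcal{R}^{S}\big)\;\le\;\frac{\mathrm{KL}(\mathfrak{Q}\|\mathfrak{P})+\log\frac{2\sqrt M}{\delta}}{M},$$ where $M=\sum_{i=1}^n m_i$, $\mathcal{R}^S=\sum_{i=1}^n\frac{m_i}{M}\mathcal{R}_i(Q_i)$ and $\widehat{\mathcal{R}}^S=\sum_{i=1}^n\frac{m_i}{M}\widehat{\mathcal{R}}_i(Q_i)=\frac1M\sum_{i=1}^n\sum_{j=1}^{m_i}\ell_i(Q_i,z_{ij})$.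
   Context: Multi-task setting: $n$ tasks; task $i$ has an unknown distribution $D_i$ on $\mathcal{Z}$, a loss $\ell_i:\mathcal{F}\times\mathcal{Z}\to[0,1]$, and a training set $S_i=(z_{i1},\dots,z_{im_i})$ of $m_i\ge1$ i.i.d. samples from $D_i$, the $S_i$ mutually independent. $\mathcal{M}(\mathcal{F})$ is the set of probability distributions on $\mathcal{F}$. For $Q\in\mathcal{M}(\mathcal{F})$: $\ell_i(Q,z)=\mathbb{E}_{f\sim Q}\ell_i(f,z)$, $\mathcal{R}_i(Q)=\mathbb{E}_{z\sim D_i}\ell_i(Q,z)$, $\widehat{\mathcal{R}}_i(Q)=\frac1{m_i}\sum_{j=1}^{m_i}\ell_i(Q,z_{ij})$. Hyper-prior $\mathcal{P}$ (data-independent) and hyper-posterior $\mathcal{Q}$ are distributions on $\mathcal{M}(\mathcal{F})$; posteriors $Q_i\in\mathcal{M}(\mathcal{F})$; $\mathcal{Q},Q_i$ may depend on the data. $\mathfrak{Q}=\mathcal{Q}\times Q_1\times\cdots\times Q_n$ on $\mathcal{M}(\mathcal{F})\times\mathcal{F}^n$; $\mathfrak{P}$ on the same space is generated by $P\sim\mathcal{P}$, then $f_1,\dots,f_n$ i.i.d. $\sim P$. $\mathrm{KL}$ is the Kullback–Leibler divergence, and $\mathrm{kl}(q|p)=q\log\frac qp+(1-q)\log\frac{1-q}{1-p}$ (convention $0\log0=0$). *)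

(* Defs.v *)
From HB Require Import structures.
From mathcomp Require Import all_boot all_order all_algebra.
From mathcomp Require Import all_classical all_reals all_analysis.

Set Implicit Arguments.
Unset Strict Implicit.
Unset Printing Implicit Defensive.

Import Order.TTheory GRing.Theory Num.Theory.

Local Open Scope classical_set_scope.
Local Open Scope ring_scope.

Definition kl_term (R : realType) (a b : R) : \bar R :=
  if a == 0 then 0%E
  else if b == 0 then +oo%E
  else (a * ln (a / b))%:E.

Definition kl (R : realType) (q p : R) : \bar R :=
  (kl_term q p + kl_term (1 - q) (1 - p))%E.

(** Kullback-Leibler divergence KL(mu || nu) between probability measures:
    if mu << nu, it is \int f log f dnu with f = dmu/dnu the Radon-Nikodym
    derivative (0 log 0 = 0, since ln 0 = 0 in MathComp); otherwise +oo. *)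
Definition KL d (T : measurableType d) (R : realType)
  (mu nu : probability T R) : \bar R :=
  if pselect (charge_of_finite_measure mu `<< nu) then
    let f := fun x => fine (Radon_Nikodym (charge_of_finite_measure mu) nu x) in
    (\int[nu]_x (f x * ln (f x))%:E)%E
  else +oo%E.

Definition cyl (T : Type) (n : nat) (B : 'I_n -> set T) : set (n.-tuple T) :=
  [set t | forall i, B i (tnth t i)].

(** frakP: the law of (P, f_1, ..., f_n) where P ~ hP and f_i i.i.d. ~ P,
    characterised by its values on measurable rectangles (which form a
    pi-system generating the product sigma-algebra, so this determines it). *)
Definition is_frakP dF (F : measurableType dF) (R : realType) (n : nat)
  (hP : probability (pprobability F R) R)
  (fP : probability (pprobability F R * n.-tuple F)%type R) : Prop :=
  forall (A : set (pprobability F R)) (B : 'I_n -> set F),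
    measurable A -> (forall i, measurable (B i)) ->
    fP (A `*` cyl B) =
      (\int[hP]_(P in A) \prod_(i < n) (P : probability F R) (B i))%E.

Definition is_frakQ dF (F : measurableType dF) (R : realType) (n : nat)
  (hQ : probability (pprobability F R) R) (Q : 'I_n -> probability F R)
  (fQ : probability (pprobability F R * n.-tuple F)%type R) : Prop :=
  forall (A : set (pprobability F R)) (B : 'I_n -> set F),
    measurable A -> (forall i, measurable (B i)) ->
    fQ (A `*` cyl B) = (hQ A * \prod_(i < n) Q i (B i))%E.

Definition lossQ dF (F : measurableType dF) (Z : Type) (R : realType)
  (l : F -> Z -> R) (Q : probability F R) (z : Z) : R :=
  fine (\int[Q]_f (l f z)%:E)%E.

Definition risk dF (F : measurableType dF) dZ (Z : measurableType dZ)
  (R : realType) (D : probability Z R) (l : F -> Z -> R) (Q : probability F R) : R :=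
  fine (\int[D]_z (lossQ l Q z)%:E)%E.

Definition emp_risk dF (F : measurableType dF) (Z : Type) (R : realType)
  (m : nat) (l : F -> Z -> R) (Q : probability F R) (s : 'I_m -> Z) : R :=
  (m%:R)^-1 * \sum_(j < m) lossQ l Q (s j).

(** Samples drawn on an abstract probability space (Omega, Pr):
    z i j : Omega -> Z is the j-th sample of task i.  The family
    (z i j)_{i,j} is mutually independent and z i j has law D i, i.e.
    S_i = (z_i1, ..., z_im_i) is i.i.d. from D_i and the S_i are independent. *)
Definition iid_samples dO (Omega : measurableType dO) dZ (Z : measurableType dZ)
  (R : realType) (Pr : probability Omega R) (n : nat) (m : 'I_n -> nat)
  (D : 'I_n -> probability Z R) (z : forall i : 'I_n, 'I_(m i) -> Omega -> Z) : Prop :=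
  (forall i j, measurable_fun [set: Omega] (z i j)) /\
  forall B : forall i : 'I_n, 'I_(m i) -> set Z,
    (forall i j, measurable (B i j)) ->
    Pr [set w | forall i j, B i j (z i j w)] =
      (\prod_(i < n) \prod_(j < m i) D i (B i j))%E.

(* Main.v *)
Require Import Defs.
From HB Require Import structures.
From mathcomp Require Import all_boot all_order all_algebra.
From mathcomp Require Import all_classical all_reals all_analysis.
From mathcomp Require Import measurable_realfun ring lra.
Import Order.TTheory GRing.Theory Num.Theory.
Import numFieldNormedType.Exports.
Local Open Scope classical_set_scope.
Local Open Scope ring_scope.

(** For all [r, s > 0], [kl q p] dominates
    [q ln r + (1 - q) ln s + 1 - r p - s (1 - p)], with equality for the best
    [r, s]; this function is affine in [(q, p)].  Averaging it over frakQ
    therefore turns the losses of the individual hypotheses into those of the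
    posteriors, and by Donsker-Varadhan the average is at most
    [KL(frakQ || frakP) + ln \int exp(M kl) dfrakP], divided by [M].

    On an event of probability [1 - delta] the last integral is at most
    [2 sqrt M / delta], by Markov and Fubini: the prior does not depend on the
    data, and for fixed hypotheses the expectation of [exp(M kl)] is at most
    [2 sqrt M].  By convexity the losses may be replaced by Bernoulli variables
    with the same means, and by Hoeffding (1956) these means may be made equal;
    for the binomial law the bound says that the Krichevsky-Trofimov mixture
    loses at most a factor [2 sqrt M] against the maximum likelihood.

    The best [r, s] depend on the data and on the posteriors, whereas the event
    may not: it is defined by the mean of [lik_ratio], which dominates the
    exponentials for all [r, s] at once and is valued in [\bar R] to cover the
    means 0 and 1. *)

(** * Rational bounds on the logarithm *)

(** Differentiability is asked on all of [-1 < x] so that it covers the endpoint 0 and gives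
    continuity on [[0, x]]. *)
Lemma ge0_of_derive_ge0 (R : realType) (g dg : R -> R) :
  g 0 = 0 -> (forall x : R, -1 < x -> is_derive x 1 g (dg x)) ->
  (forall x : R, 0 <= x -> 0 <= dg x) -> forall x : R, 0 <= x -> 0 <= g x.
Proof.
move=> g0 dgE dg0 x x0.
rewrite -g0.
have N1 (y : R) : 0 <= y -> -1 < y by move=> y0; apply: lt_le_trans y0; lra.
apply: (@ger0_derive1_ndecr _ g 0 x) => //.
- by move=> y; rewrite in_itv/= => /andP[/ltW/N1 y0 _]; have [] := dgE _ y0.
- move=> y; rewrite in_itv/= => /andP[/ltW y0 _].
  by rewrite derive1E; have [_ ->] := dgE _ (N1 _ y0); exact: dg0.
- apply: derivable_within_continuous => y; rewrite in_itv/= => /andP[/N1 y0 _].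
  by have [] := dgE _ y0.
Qed.

(** The lower bound is the Padé approximant of type [1/1], exact to second order at 0; the
    difference then has a visibly nonnegative derivative. *)
Lemma ln1D_ge (R : realType) (x : R) : 0 <= x -> 2 * x / (2 + x) <= ln (1 + x).
Proof.
move=> x0; rewrite -subr_ge0.
apply: (@ge0_of_derive_ge0 R (fun x => ln (1 + x) - 2 * x / (2 + x))
   (fun x => (1 + x)^-1 - 4 / (2 + x) ^+ 2)) => //.
- by rewrite addr0 ln1 mulr0 mul0r subr0.
- move=> y y1.
  have y2 : 0 < 1 + y by lra.
  have y3 : 2 + y != 0 by rewrite gt_eqF//; lra.
  have H := is_derive1_ln y2.
  apply: is_derive_eq.
  rewrite /GRing.scale /=; field.
  by rewrite y3 gt_eqF.
- move=> y y0; rewrite [leRHS](_ : _ = y ^+ 2 / ((1 + y) * (2 + y) ^+ 2)).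
    by rewrite divr_ge0 ?mulr_ge0 ?exprn_ge0//; lra.
  by field; apply/andP; split; rewrite gt_eqF//; lra.
Qed.

(** Same argument with the Padé approximant of type [2/1], exact to third order; this precision
    serves [half_rising_step]. *)
Lemma ln1D_le (R : realType) (x : R) :
  0 <= x -> ln (1 + x) <= x * (6 + x) / (6 + 4 * x).
Proof.
move=> x0; rewrite -subr_ge0.
apply: (@ge0_of_derive_ge0 R (fun x => x * (6 + x) / (6 + 4 * x) - ln (1 + x))
   (fun x => (36 + 12 * x + 4 * x ^+ 2) / (6 + 4 * x) ^+ 2 - (1 + x)^-1)) => //.
- by rewrite mul0r mul0r addr0 ln1 subr0.
- move=> y y1.
  have y2 : 0 < 1 + y by lra.
  have y3 : 6 + 4 * y != 0 by rewrite gt_eqF//; lra.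
  have H := is_derive1_ln y2.
  apply: is_derive_eq.
  rewrite /GRing.scale /=; field.
  by rewrite y3 gt_eqF.
- move=> y y0.
  rewrite [leRHS](_ : _ = 4 * y ^+ 3 / ((1 + y) * (6 + 4 * y) ^+ 2)).
    by rewrite divr_ge0 ?mulr_ge0 ?exprn_ge0//; lra.
  by field; apply/andP; split; rewrite gt_eqF//; lra.
Qed.

(** * The Krichevsky-Trofimov mixture against the maximum likelihood *)

Section Krichevsky_Trofimov.
Variable R : realType.
Implicit Types a b n : nat.

(* The rising factorial of 1/2. *)
Definition half_rising a : R := \prod_(i < a) (i%:R + 2^-1).

(* The probability that the Krichevsky-Trofimov predictor, i.e. the
   Beta(1/2, 1/2) mixture of Bernoulli laws, gives to a fixed sequence of [a]
   ones and [b] zeros. *)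
Definition KT a b : R := half_rising a * half_rising b / (a + b)`!%:R.

Lemma half_risingS a : half_rising a.+1 = half_rising a * (a%:R + 2^-1).
Proof. by rewrite /half_rising big_ord_recr. Qed.

Lemma half_rising_gt0 a : 0 < half_rising a.
Proof.
by apply: prodr_gt0 => i _; rewrite ltr_wpDl// invr_gt0.
Qed.

(* The logarithms of the two sides differ by about [1 / (24 a^2)] only, whence
   the sharp bounds on [ln]. *)
Lemma half_rising_step a : (0 < a)%N ->
  a.+1%:R ^+ a.+1 <= a%:R ^+ a * (a%:R + 2^-1) * expR 1 :> R.
Proof.
rewrite -(ltr_nat R) => a0; set x : R := a%:R in a0 *.
have a1 : 1 <= x by rewrite ler1n -(ltr_nat R).
have x1 : 0 < x + 1 by lra.
have x2 : 0 < x + 2^-1 by lra.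
rewrite -natr1 -/x -ler_ln ?posrE ?mulr_gt0 ?exprn_gt0 ?expR_gt0//.
rewrite !lnM ?posrE ?mulr_gt0 ?exprn_gt0 ?expR_gt0// expRK !lnXn//.
have E1 : ln (x + 1) = ln x + ln (1 + x^-1).
  rewrite -lnM ?posrE ?addr_gt0 ?invr_gt0//.
  by congr ln; rewrite mulrDr mulr1 mulfV ?gt_eqF.
have E2 : ln (x + 2^-1) = ln x + ln (1 + x^-1 / 2).
  rewrite -lnM ?posrE ?addr_gt0 ?divr_gt0 ?invr_gt0//.
  by congr ln; rewrite mulrDr mulr1 mulrA mulfV ?gt_eqF// mul1r.
rewrite E1 E2 -(mulr_natl (ln x)) -(mulr_natl (ln x + _)) -natr1 -/x.
have xV : 0 <= x^-1 by rewrite invr_ge0 ltW.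
have := ln1D_le _ _ xV.
have xV2 : 0 <= x^-1 / 2 by rewrite divr_ge0.
have := ln1D_ge _ _ xV2.
set u := ln (1 + _ / _); set v := ln (1 + _) => hu hv.
(* The terms in [ln x] cancel, leaving [(x + 1) * v <= u + 1]; the Padé bounds turn this into a
   rational inequality, which is an equality at [x = 1]. *)
suff : (x + 1) * (x^-1 * (6 + x^-1) / (6 + 4 * x^-1)) <=
       2 * (x^-1 / 2) / (2 + x^-1 / 2) + 1.
  move=> H; have : (x + 1) * v <= u + 1.
    have hvx := ler_wpM2l (ltW x1) hv.
    by apply: (le_trans hvx); apply: (le_trans H); rewrite lerD2r.
  lra.
rewrite -subr_ge0 [leRHS](_ : _ = (x - 1) / (x * (6 * x + 4) * (4 * x + 1))).
  by rewrite divr_ge0 ?mulr_ge0//; lra.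
by field; rewrite !gt_eqF//; lra.
Qed.

(** [half_rising_step] compares the ratios of consecutive terms, and the constant [expR 1 / 2] gives
    equality at [a = 1]. The bound fails at [a = 0], where the power is 1. *)
Lemma half_rising_ge a : (0 < a)%N ->
  expR 1 / 2 * a%:R ^+ a <= half_rising a * expR 1 ^+ a.
Proof.
elim: a => // -[_ _|a IH _].
  by rewrite /half_rising big_ord1 !expr1 add0r mulr1 mulrC.
rewrite half_risingS (exprS (expR 1)).
move: (ltn0Sn a) (IH isT); move: a.+1 => y y0 {}IH.
have h := half_rising_step y y0.
apply: (@le_trans _ _ (expR 1 / 2 * (y%:R ^+ y * (y%:R + 2^-1) * expR 1))).
  by rewrite ler_wpM2l// divr_ge0 ?expR_ge0.
rewrite [leLHS](_ : _ = (expR 1 / 2 * y%:R ^+ y) * ((y%:R + 2^-1) * expR 1)); last by ring.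
rewrite [leRHS](_ : _ = (half_rising y * expR 1 ^+ y) * ((y%:R + 2^-1) * expR 1)); last by ring.
by rewrite ler_wpM2r// mulr_ge0 ?expR_ge0// addr_ge0// invr_ge0.
Qed.

Lemma ln_sqrt (x : R) : 0 < x -> ln (Num.sqrt x) = ln x / 2.
Proof.
move=> x0; have := sqr_sqrtr (ltW x0) => /(congr1 (@ln R)).
rewrite lnXn ?sqrtr_gt0// => <-; rewrite -(mulr_natl (ln _)) mulrAC.
by rewrite divff// mul1r.
Qed.

(** A Stirling upper bound, with equality at [n = 1]. The induction step amounts to
    [1 <= (x + 1/2) * ln (1 + 1/x)], which is [ln1D_ge] at [1/x]. *)
Lemma fact_le n : (0 < n)%N ->
  n`!%:R * expR 1 ^+ n <= expR 1 * n%:R ^+ n * Num.sqrt n%:R :> R.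
Proof.
elim: n => // -[_ _|n IH _].
  by rewrite factS fact0 muln1 !expr1 sqrtr1 !mulr1 mul1r.
move: (ltn0Sn n) (IH isT); move: n.+1 => y y0 {}IH.
rewrite factS natrM exprS.
set x : R := y%:R in IH *.
have x0 : 0 < x by rewrite ltr0n.
have x1 : 0 < x + 1 by lra.
have y1 : y.+1%:R = x + 1 by rewrite /x natr1.
have h : x ^+ y * Num.sqrt x * (x + 1) * expR 1 <= (x + 1) ^+ y.+1 * Num.sqrt (x + 1).
  rewrite -ler_ln ?posrE ?mulr_gt0 ?exprn_gt0 ?sqrtr_gt0 ?expR_gt0//.
  rewrite !lnM ?posrE ?mulr_gt0 ?exprn_gt0 ?sqrtr_gt0 ?expR_gt0//.
  rewrite expRK !lnXn// !ln_sqrt//.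
  have E1 : ln (x + 1) = ln x + ln (1 + x^-1).
    rewrite -lnM ?posrE ?addr_gt0 ?invr_gt0//.
    by congr ln; rewrite mulrDr mulr1 mulfV ?gt_eqF.
  rewrite E1 -(mulr_natl (ln x)) -(mulr_natl (ln x + _)) y1 -/x.
  have xV : 0 <= x^-1 by rewrite invr_ge0 ltW.
  have := ln1D_ge _ _ xV; set v := ln (1 + _) => hv.
  have : 1 <= (x + 2^-1) * v.
    apply: le_trans (ler_wpM2l _ hv); last lra.
    by rewrite le_eqVlt; apply/orP; left; apply/eqP; field; rewrite !gt_eqF//; lra.
  lra.
rewrite y1.
apply: (@le_trans _ _ ((x + 1) * expR 1 * (expR 1 * x ^+ y * Num.sqrt x))).
  rewrite [leLHS](_ : _ = (x + 1) * expR 1 * (y`!%:R * expR 1 ^+ y)); last by ring.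
  by rewrite ler_wpM2l// mulr_ge0 ?expR_ge0// ltW.
rewrite [leLHS](_ : _ = expR 1 * (x ^+ y * Num.sqrt x * (x + 1) * expR 1)); last by ring.
by rewrite -[leRHS]mulrA ler_wpM2l ?expR_ge0.
Qed.

Lemma max_likelihood_le_KT a b : (0 < a + b)%N ->
  (a%:R / (a + b)%:R) ^+ a * (b%:R / (a + b)%:R) ^+ b
  <= 2 * Num.sqrt (a + b)%:R * KT a b :> R.
Proof.
move=> n0; set n := (a + b)%N in n0 *.
have nr0 : 0 < n%:R :> R by rewrite ltr0n.
have e2 : 2 <= expR 1 :> R by rewrite -[leLHS]/(1 + 1) expR_ge1Dx.
have e0 : 0 < expR 1 :> R := expR_gt0 1.
(* If one count is 0, the single factor [expR 1 / 2] from [half_rising_ge] is exactly what is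
   needed; if both are positive, a second such factor is dropped, as it is at least 1. *)
have hab : a%:R ^+ a * b%:R ^+ b * expR 1 <= 2 * (half_rising a * half_rising b) * expR 1 ^+ n.
  rewrite /n exprD.
  have [a0|a0] := posnP a; have [b0|b0] := posnP b.
  - by move: n0; rewrite /n a0 b0.
  - rewrite a0 !expr0 /half_rising big_ord0 !mul1r.
    by have := half_rising_ge b b0; rewrite /half_rising; lra.
  - rewrite b0 !expr0 /half_rising big_ord0 !mulr1.
    by have := half_rising_ge a a0; rewrite /half_rising; lra.
  - have ha := half_rising_ge a a0; have hb := half_rising_ge b b0.
    have A0 : 0 <= a%:R ^+ a :> R by rewrite exprn_ge0.
    have B0 : 0 <= b%:R ^+ b :> R by rewrite exprn_ge0.
    have h := ler_pM (mulr_ge0 (divr_ge0 (ltW e0) (ler0n _ 2)) A0)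
      (mulr_ge0 (divr_ge0 (ltW e0) (ler0n _ 2)) B0) ha hb.
    apply: (@le_trans _ _ (2 * (expR 1 / 2 * a%:R ^+ a * (expR 1 / 2 * b%:R ^+ b)))).
      have AB := mulr_ge0 (mulr_ge0 A0 B0) (ltW e0).
      have := ler_wpM2l AB e2; lra.
    have := ler_wpM2l (ler0n R 2) h; lra.
have hn := fact_le n n0.
have f0 : 0 < n`!%:R :> R by rewrite ltr0n fact_gt0.
rewrite /KT -/n !expr_div_n.
rewrite [leLHS](_ : _ = a%:R ^+ a * b%:R ^+ b / n%:R ^+ n); last first.
  by rewrite /n exprD invfM; ring.
rewrite ler_pdivrMr ?exprn_gt0// mulrA (mulrAC _ _^-1) ler_pdivlMr//.
rewrite -(ler_pM2r (mulr_gt0 e0 (exprn_gt0 n e0))).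
set A := _ * _ ^+ b in hab *.
have A0 : 0 <= A by rewrite mulr_ge0 ?exprn_ge0.
rewrite [leLHS](_ : _ = (A * expR 1) * (n`!%:R * expR 1 ^+ n)); last by ring.
rewrite [leRHS](_ : _ = (2 * (half_rising a * half_rising b) * expR 1 ^+ n) *
   (expR 1 * n%:R ^+ n * Num.sqrt n%:R)); last by ring.
by apply: ler_pM => //; rewrite mulr_ge0 ?exprn_ge0// ltW.
Qed.

Lemma KT00 : KT 0 0 = 1.
Proof. by rewrite /KT /half_rising !big_ord0 addn0 fact0 invr1 !mulr1. Qed.

Lemma KT_ge0 a b : 0 <= KT a b.
Proof. by rewrite /KT divr_ge0// mulr_ge0// ltW// half_rising_gt0. Qed.

Lemma KTSl a b : KT a.+1 b = KT a b * ((a%:R + 2^-1) / (a + b).+1%:R).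
Proof. by rewrite /KT half_risingS addSn factS natrM invfM; ring. Qed.

Lemma KTSr a b : KT a b.+1 = KT a b * ((b%:R + 2^-1) / (a + b).+1%:R).
Proof. by rewrite /KT half_risingS addnS factS natrM invfM; ring. Qed.

(** The predictive probabilities [(a + 1/2) / (a + b + 1)] and [(b + 1/2) / (a + b + 1)] add up to
    1. *)
Lemma KT_split a b : KT a.+1 b + KT a b.+1 = KT a b.
Proof.
rewrite KTSl KTSr -mulrDr -mulrDl addrACA -natrD.
have -> : (a + b)%:R + (2^-1 + 2^-1) = (a + b).+1%:R :> R by rewrite -[in RHS]natr1; lra.
by rewrite divff ?mulr1.
Qed.

(** In terms of the Beta mixture, the difference of the two sides is the integral of
    [x^a (1 - x)^b ((1 - x) v - x u)^2]. With [u = 1/p] and [v = 1/(1 - p)] it is the convexity in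
    the number of ones of the ratio between [KT] and the Bernoulli likelihood. *)
Lemma KT_convex a b (u v : R) :
  2 * (KT a.+1 b.+1 * u * v) <= KT a b.+2 * v ^+ 2 + KT a.+2 b * u ^+ 2.
Proof.
rewrite !(KTSl, KTSr) !addSn !addnS.
set c := (a + b).+1%:R; set d := (a + b).+2%:R.
have c0 : 0 < c by rewrite ltr0n.
have d0 : 0 < d by rewrite ltr0n.
rewrite -subr_ge0 -(natr1 a) -(natr1 b).
set x : R := a%:R; set y : R := b%:R.
rewrite [leRHS](_ : _ = KT a b / (c * d) * (((y + 2^-1) * v - (x + 2^-1) * u) ^+ 2
   + (y + 2^-1) * v ^+ 2 + (x + 2^-1) * u ^+ 2)); last first.
  by field; rewrite !gt_eqF.
have ? : 0 <= x by []. have ? : 0 <= y by [].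
apply: mulr_ge0; first by rewrite divr_ge0 ?KT_ge0// ltW// mulr_gt0.
by rewrite addr_ge0 ?addr_ge0 ?sqr_ge0 ?(mulr_ge0 _ (sqr_ge0 _))//; lra.
Qed.

End Krichevsky_Trofimov.

(** * Expectations under Poisson-binomial laws *)

Section Poisson_binomial.
Variable R : realType.
Implicit Types (s : seq R) (phi psi : nat -> R) (n k : nat) (p q r t x y : R).

(* The expectation of [phi S], where [S] is a sum of independent Bernoulli
   variables whose means are the entries of [s]. *)
Fixpoint pbE s phi : R :=
  if s is x :: s' then x * pbE s' (phi \o succn) + (1 - x) * pbE s' phi
  else phi 0%N.

Lemma eq_pbE s phi psi : (forall k, (k <= size s)%N -> phi k = psi k) ->
  pbE s phi = pbE s psi.
Proof.
elim: s phi psi => [|x s IH] phi psi h /=; first exact: h.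
congr (_ * _ + _ * _); apply: IH => k ks; apply: h => //=.
exact: leqW.
Qed.

Lemma pbE_linear s a phi psi :
  pbE s (fun k => a * phi k + psi k) = a * pbE s phi + pbE s psi.
Proof.
elim: s phi psi => [//|x s IH] phi psi /=.
by rewrite -[X in x * X]/(pbE s (fun k => a * (phi \o succn) k + (psi \o succn) k)) !IH; ring.
Qed.

Lemma pbEZ s a phi : pbE s (fun k => a * phi k) = a * pbE s phi.
Proof.
elim: s phi => [//|x s IH] phi /=.
by rewrite -[X in x * X]/(pbE s (fun k => a * (phi \o succn) k)) !IH; ring.
Qed.

Lemma le_pbE s phi psi : all (fun x => 0 <= x <= 1) s ->
  (forall k, (k <= size s)%N -> phi k <= psi k) -> pbE s phi <= pbE s psi.
Proof.
elim: s phi psi => [|x s IH] phi psi /=; first by move=> _; exact.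
move=> /andP[/andP[x0 x1] s01] h; apply: lerD; apply: ler_wpM2l.
- by [].
- by apply: IH => // k ks; exact: h.
- by rewrite subr_ge0.
- by apply: IH => // k ks; apply: h; exact: leqW.
Qed.

(** Two entries matter only through their sum and product, and the product is weighted by a mean
    second difference of [phi]. This yields both the exchange of entries and the smoothing of a
    pair. *)
Lemma pbE2 x y s phi : pbE [:: x, y & s] phi = pbE s phi +
  (x + y) * (pbE s (phi \o succn) - pbE s phi) +
  x * y * (pbE s (phi \o succn \o succn) - 2 * pbE s (phi \o succn) + pbE s phi).
Proof. by rewrite /=; ring. Qed.

Lemma pbE_rem x s phi : x \in s -> pbE s phi = pbE (x :: rem x s) phi.
Proof.
elim: s phi => [//|y s IH] phi; rewrite inE => /predU1P[->|xs].
  by rewrite [in RHS]/= eqxx.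
rewrite [rem _ _]/=; case: eqVneq => [->//|_].
have -> : pbE [:: x, y & rem x s] phi = pbE [:: y, x & rem x s] phi.
  by rewrite !pbE2 (addrC x) (mulrC x).
by rewrite [LHS]/= !(IH _ xs).
Qed.

(* Two entries on opposite sides of the mean [p] may be moved to [p] and
   [x + y - p]: the sum is unchanged and the product does not decrease. *)
Lemma pbE_smooth x y p s phi : all (fun x => 0 <= x <= 1) s ->
  0 <= (p - x) * (y - p) ->
  (forall k, (k.+2 <= (size s).+2)%N -> 2 * phi k.+1 <= phi k + phi k.+2) ->
  pbE [:: x, y & s] phi <= pbE [:: p, x + y - p & s] phi.
Proof.
move=> s01 h cvx; rewrite !pbE2.
rewrite (_ : p + (x + y - p) = x + y); last by ring.
rewrite lerD2l -subr_ge0 -mulrBl.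
rewrite (_ : _ - x * y = (p - x) * (y - p)); last by ring.
rewrite mulr_ge0//.
have := @le_pbE s (fun k => 2 * (phi \o succn) k)
  (fun k => 1 * phi k + (phi \o succn \o succn) k) s01.
rewrite pbE_linear pbEZ mul1r => H.
have /H : forall k, (k <= size s)%N ->
  2 * (phi \o succn) k <= 1 * phi k + (phi \o succn \o succn) k.
  by move=> k ks /=; rewrite mul1r; exact: cvx.
lra.
Qed.

(** The deviations from [p] add up to 0, so they are neither all positive nor all negative. *)
Lemma exists_le_ge_mean s p : s != [::] -> \sum_(x <- s) x = (size s)%:R * p ->
  (exists2 y, y \in s & y <= p) /\ (exists2 y, y \in s & p <= y).
Proof.
have aux s' : \sum_(x <- s') (x - p) = \sum_(x <- s') x - (size s')%:R * p.
  by rewrite sumrB big_const_seq count_predT iter_addr addr0 mulr_natl.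
move=> s0 hs; have := aux s; rewrite hs subrr => h0.
split; apply/exists2P; apply: contrapT => /forallNP H.
- have hpos y : y \in s -> 0 < y - p.
    by move=> ys; rewrite subr_gt0 ltNge; apply/negP => yp; exact: (H y).
  case: s s0 h0 hpos {hs H} => // y s _ h0 hpos.
  move: h0; rewrite big_cons; apply/eqP; rewrite gt_eqF// ltr_pwDl//.
    by rewrite hpos// mem_head.
  by rewrite big_seq; apply: sumr_ge0 => z zs; rewrite ltW// hpos// inE zs orbT.
- have hpos y : y \in s -> 0 < p - y.
    by move=> ys; rewrite subr_gt0 ltNge; apply/negP => yp; exact: (H y).
  case: s s0 h0 hpos {hs H} => // y s _ h0 hpos.
  move: h0; rewrite big_cons; apply/eqP; rewrite lt_eqF// -oppr_gt0 opprD opprB ltr_pwDl//.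
    by rewrite hpos// mem_head.
  rewrite -sumrN big_seq; apply: sumr_ge0 => z zs.
  by rewrite opprB ltW// hpos// inE zs orbT.
Qed.

(* Hoeffding (1956): for a convex [phi] the binomial law maximises the
   expectation among Poisson-binomial laws with a given mean. *)
Lemma pbE_le_binomial s p phi : all (fun x => 0 <= x <= 1) s ->
  \sum_(x <- s) x = (size s)%:R * p ->
  (forall k, (k.+2 <= size s)%N -> 2 * phi k.+1 <= phi k + phi k.+2) ->
  pbE s phi <= pbE (nseq (size s) p) phi.
Proof.
have [n] := ubnP (size s); elim: n s phi => // n IH [//|x s] phi.
rewrite [size _]/= ltnS => sn s01 hs cvx.
have /andP[/andP[x0 x1] s01'] : (0 <= x <= 1) && all (fun x => 0 <= x <= 1) s := s01.
have p01 : 0 <= p <= 1.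
  have [[y ys yp] [y' ys' yp']] := exists_le_ge_mean (x :: s) p isT hs.
  have /andP[? ?] := allP s01 _ ys; have /andP[? ?] := allP s01 _ ys'.
  by apply/andP; split; [exact: le_trans yp|exact: le_trans yp' _].
have [p0 p1] := andP p01.
move: hs; rewrite big_cons -natr1 mulrDl mul1r => hs.
(* Once the head equals [p], the tail has mean [p] as well, and the induction hypothesis applies in
   both branches, to [phi] and to its shift. *)
have tail (t : seq R) : size t = size s -> all (fun x => 0 <= x <= 1) t ->
    \sum_(x <- t) x = (size t)%:R * p ->
    pbE (p :: t) phi <= pbE (nseq (size s).+1 p) phi.
  move=> ts t01 ht; rewrite /= -ts; apply: lerD; apply: ler_wpM2l => //.
  - apply: IH => //; first by rewrite ts.
    by move=> k kt; apply: cvx; rewrite -ts ltnS.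
  - by rewrite subr_ge0.
  - apply: IH => //; first by rewrite ts.
    by move=> k kt; apply: cvx; rewrite -ts ltnW.
have [s0|s0] := eqVneq s [::].
  move: hs; rewrite s0 big_nil addr0 mul0r add0r => <-.
  by rewrite lexx.
suff [y ys xpy] : exists2 y, y \in s & 0 <= (p - x) * (y - p).
  have s01r : all (fun x => 0 <= x <= 1) (rem y s).
    by apply/allP => z /mem_rem zs; exact: (allP s01').
  have [y0 y1] := andP (allP s01' _ ys).
  have sz : (size (rem y s)).+1 = size s by rewrite size_rem// prednK// lt0n size_eq0.
  have -> : pbE (x :: s) phi = pbE [:: x, y & rem y s] phi.
    by rewrite [LHS]/= (pbE_rem y s (phi \o succn) ys) (pbE_rem y s phi ys).
  apply: le_trans (pbE_smooth _ _ p _ _ s01r xpy _) _.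
    by move=> k kt; apply: cvx; rewrite -sz.
  apply: tail => //=.
  - rewrite s01r andbT; apply/andP.
    have [xp|xp|xp] := ltgtP x p.
    + by move: xpy; rewrite pmulr_rge0 ?subr_gt0// subr_ge0; split; lra.
    + by move: xpy; rewrite nmulr_rge0 ?subr_lt0// subr_le0; split; lra.
    + by split; lra.
  - rewrite big_cons sz.
    have := hs; rewrite (big_rem y ys)/=; lra.
(* The mean of the other entries deviates from [p] on the side opposite to [x], so one of them lies
   on that side. *)
have hs' : \sum_(z <- s) z = (size s)%:R * (p + (p - x) / (size s)%:R).
  rewrite mulrDr mulrCA divff ?mulr1; first lra.
  by rewrite pnatr_eq0 size_eq0.
have sz0 : 0 <= (size s)%:R^-1 :> R by rewrite invr_ge0.
have [[y ys yp] [z zs zp]] := exists_le_ge_mean s _ s0 hs'.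
have [xp|xp] := leP x p.
- exists z => //; rewrite mulr_ge0 ?subr_ge0//; apply: le_trans zp.
  by rewrite lerDl mulr_ge0// subr_ge0.
- exists y => //; rewrite mulr_le0 ?subr_le0 ?(ltW xp)//; apply: le_trans yp _.
  by rewrite gerDl mulr_le0_ge0// subr_le0 ltW.
Qed.

(** A change of measure: the division trades the Bernoulli law for the mixture, whose continuations
    of a sequence with counts [a], [b] have total mass [KT a b] by [KT_split]. *)
Lemma pbE_nseq_KT p n a b : p != 0 -> 1 - p != 0 ->
  pbE (nseq n p) (fun k => KT R (a + k) (b + (n - k)) / (p ^+ k * (1 - p) ^+ (n - k)))
  = KT R a b.
Proof.
move=> p0 p1; elim: n a b => [|n IH] a b /=.
  by rewrite !addn0 !expr0 mulr1 divr1.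
set G := fun k : nat => _.
have -> : pbE (nseq n p) (G \o succn) = p^-1 * KT R a.+1 b.
  rewrite -(IH a.+1 b) -pbEZ; apply: eq_pbE => k _ /=.
  by rewrite /G addnS subSS exprS -mulrA invfM mulrCA.
have -> : pbE (nseq n p) G = (1 - p)^-1 * KT R a b.+1.
  rewrite -(IH a b.+1) -pbEZ; apply: eq_pbE => k; rewrite size_nseq => kn.
  rewrite /G subSn// exprS addnS addSn; field.
  by rewrite p1 !expf_neq0.
by rewrite !mulrA !divff// !mul1r KT_split.
Qed.

(** [ln] lies below its tangent at the weighted mean [m]. This is the step that replaces a loss in
    [[0, 1]] by a Bernoulli variable of the same mean. *)
Lemma weighted_AMGM x r t : 0 <= x <= 1 -> 0 < r -> 0 < t ->
  expR (x * ln r + (1 - x) * ln t) <= x * r + (1 - x) * t.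
Proof.
move=> /andP[x0 x1] r0 t0; set m := x * r + _.
have m0 : 0 < m.
  rewrite /m; have [->|xn0] := eqVneq x 0; first by rewrite mul0r add0r subr0 mul1r.
  apply: ltr_pwDl; first by rewrite mulr_gt0// lt_def xn0.
  by rewrite mulr_ge0 ?subr_ge0// ltW.
have aux y : 0 < y -> ln y <= ln m + y / m - 1.
  move=> y0; have := expR_ge1Dx (ln (y / m)); rewrite lnK ?posrE ?divr_gt0//.
  by rewrite ln_div ?posrE//; lra.
rewrite -[leRHS]lnK ?posrE// ler_expR.
have hr := ler_wpM2l x0 (aux _ r0).
have x1' : 0 <= 1 - x by rewrite subr_ge0.
have ht := ler_wpM2l x1' (aux _ t0).
apply: le_trans (lerD hr ht) _.
rewrite [leLHS](_ : _ = ln m + (m / m - 1)); last by rewrite /m; ring.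
by rewrite divff ?gt_eqF// subrr addr0.
Qed.

Lemma pbE_geom s r t :
  pbE s (fun k => r ^+ k * t ^+ (size s - k)) = \prod_(x <- s) (x * r + (1 - x) * t).
Proof.
elim: s => [|x s IH] /=; first by rewrite big_nil !expr0 mulr1.
rewrite big_cons -IH [RHS]mulrDl -[_ * r * _]mulrA -[_ * t * _]mulrA.
congr (_ * _ + _ * _); rewrite -pbEZ.
  by apply: eq_pbE => k _ /=; rewrite subSS exprS mulrA.
by apply: eq_pbE => k ks; rewrite subSn// exprS mulrCA.
Qed.

(** For [k > 0] this is the [k]-th power of [y <= expR (y - 1)] at [y = n * u / k]. *)
Lemma exprn_le_expR n k (u : R) : (0 < n)%N -> 0 <= u ->
  u ^+ k <= (k%:R / n%:R) ^+ k * expR (n%:R * u - k%:R).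
Proof.
move=> n0 u0; have [->|k0] := posnP k.
  by rewrite !expr0 mul1r subr0 -expR0 ler_expR mulr_ge0.
have kr : 0 < k%:R :> R by rewrite ltr0n.
have nr : 0 < n%:R :> R by rewrite ltr0n.
have -> : n%:R * u - k%:R = k%:R * (n%:R * u / k%:R - 1).
  by field; rewrite gt_eqF.
rewrite expRM_natl -exprMn; apply: lerXn2r; rewrite ?nnegrE ?mulr_ge0 ?expR_ge0//.
have := expR_ge1Dx (n%:R * u / k%:R - 1); rewrite addrC subrK => h.
apply: le_trans (ler_wpM2l _ h); last by rewrite ltW// divr_gt0.
by rewrite le_eqVlt; apply/orP; left; apply/eqP; field; rewrite !gt_eqF.
Qed.

End Poisson_binomial.

(** * The maximal likelihood ratio and its mean *)

Section likelihood_ratio.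
Variable R : realType.
Implicit Types (s : seq R) (n k : nat) (p q r t x y : R).

(** The extended-valued form of [pbE], for integrands that may be [+oo]; since [0 * +oo = 0],
    branches of probability 0 contribute nothing. *)
Fixpoint pbEe s (phi : nat -> \bar R) : \bar R :=
  if s is x :: s' then (x%:E * pbEe s' (phi \o succn) + (1 - x)%:E * pbEe s' phi)%E
  else phi 0%N.

Lemma pbEe_EFin s (phi : nat -> R) : pbEe s (EFin \o phi) = (pbE R s phi)%:E.
Proof.
elim: s phi => [//|x s IH] phi /=.
by rewrite IH -[X in pbEe s X]/(EFin \o (phi \o succn)) IH.
Qed.

Lemma pbEe_ge0 s (phi : nat -> \bar R) : all (fun x => 0 <= x <= 1) s ->
  (forall k, (0 <= phi k)%E) -> (0 <= pbEe s phi)%E.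
Proof.
elim: s phi => [|x s IH] phi /=; first by move=> _; exact.
move=> /andP[/andP[x0 x1] s01] h.
by rewrite adde_ge0 ?mule_ge0 ?lee_fin ?subr_ge0//; apply: IH => // k; exact: h.
Qed.

Lemma le_pbEe s (phi psi : nat -> \bar R) : all (fun x => 0 <= x <= 1) s ->
  (forall k, (k <= size s)%N -> (phi k <= psi k)%E) -> (pbEe s phi <= pbEe s psi)%E.
Proof.
elim: s phi psi => [|x s IH] phi psi /=; first by move=> _; exact.
move=> /andP[/andP[x0 x1] s01] h; apply: leeD; apply: lee_wpmul2l.
- by rewrite lee_fin.
- by apply: IH => // k ks; exact: h.
- by rewrite lee_fin subr_ge0.
- by apply: IH => // k ks; apply: h; exact: leqW.
Qed.

Lemma pbEe_nseq0 n (phi : nat -> \bar R) : pbEe (nseq n 0) phi = phi 0%N.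
Proof. by elim: n phi => //= n IH phi; rewrite mul0e add0e subr0 mul1e IH. Qed.

Lemma pbEe_nseq1 n (phi : nat -> \bar R) : pbEe (nseq n 1) phi = phi n.
Proof. by elim: n phi => //= n IH phi; rewrite subrr mul0e adde0 mul1e IH. Qed.

(* The maximal likelihood ratio [sup_q q^k (1-q)^(n-k) / (p^k (1-p)^(n-k))],
   i.e. [exp (n * kl (k/n | p))]. *)
Definition lik_ratio n p k : \bar R :=
  if p ^+ k * (1 - p) ^+ (n - k) == 0 then +oo%E else
  ((k%:R / n%:R) ^+ k * ((n - k)%:R / n%:R) ^+ (n - k)
   / (p ^+ k * (1 - p) ^+ (n - k)))%:E.

Lemma lik_ratio_ge0 n p k : 0 <= p <= 1 -> (0 <= lik_ratio n p k)%E.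
Proof.
move=> /andP[p0 p1]; rewrite /lik_ratio; case: ifPn => // _.
by rewrite lee_fin !(mulr_ge0, invr_ge0, exprn_ge0)// subr_ge0.
Qed.

Lemma pbEe_lik_ratio_le s p : (0 < size s)%N -> all (fun x => 0 <= x <= 1) s ->
  \sum_(x <- s) x = (size s)%:R * p ->
  (pbEe s (lik_ratio (size s) p) <= (2 * Num.sqrt (size s)%:R)%:E)%E.
Proof.
move=> s0 s01 hs; set n := size s in s0 hs *.
have nr : 1 <= n%:R :> R by rewrite ler1n.
have nr0 : n%:R != 0 :> R by rewrite gt_eqF// (lt_le_trans ltr01).
have ge1 : 1 <= 2 * Num.sqrt n%:R :> R.
  have : Num.sqrt 1 <= Num.sqrt n%:R :> R by exact: ler_wsqrtr.
  by rewrite sqrtr1; lra.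
have const0 (u : seq R) : all (fun x => 0 <= x) u -> \sum_(x <- u) x = 0 ->
    u = nseq (size u) 0.
  move=> u0 hu; apply/all_pred1P/allP => x xu /=.
  move: hu; rewrite big_seq => /eqP; rewrite psumr_eq0; last by move=> y /(allP u0).
  by move=> /allP /(_ _ xu); rewrite xu.
(* For [p = 0] all entries vanish, and for [p = 1] all are 1: the sum is then deterministic, and
   [lik_ratio] equals 1 at its only value. *)
have [p0|p0] := eqVneq p 0.
  have -> : s = nseq n 0.
    by apply: const0; [apply/allP => x /(allP s01)/andP[]|rewrite hs p0 mulr0].
  rewrite pbEe_nseq0 /lik_ratio p0 !expr0 subr0 expr1n mulr1 oner_eq0 subn0.
  by rewrite divff// expr1n mul1r invr1 mulr1 lee_fin.
have [p1|p1] := eqVneq (1 - p) 0.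
  have sE : map (fun x => 1 - x) s = nseq n 0.
    rewrite (const0 (map _ s)) ?size_map//.
      by rewrite all_map; apply/allP => x /(allP s01)/andP[_] /=; rewrite subr_ge0.
    rewrite big_map sumrB hs big_const_seq count_predT iter_addr addr0 -/n.
    have -> : p = 1 by apply/eqP; rewrite eq_sym -subr_eq0 p1.
    by rewrite mulr1 subrr.
  have -> : s = nseq n 1.
    have := congr1 (map (fun x => 1 - x)) sE; rewrite -map_comp map_nseq subr0 => <-.
    by rewrite -[LHS]map_id; apply: eq_map => x /=; rewrite subKr.
  rewrite pbEe_nseq1 /lik_ratio subnn !expr0.
  have -> : p = 1 by apply/eqP; rewrite eq_sym -subr_eq0 p1.
  by rewrite expr1n !mulr1 oner_eq0 divff// expr1n invr1 mulr1 lee_fin.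
pose phi k := KT R k (n - k) / (p ^+ k * (1 - p) ^+ (n - k)).
have p01 : 0 <= p <= 1.
  have sn0 : s != [::] by rewrite -size_eq0 -lt0n.
  have [[y ys yp] [y' ys' yp']] := exists_le_ge_mean R s p sn0 hs.
  have /andP[? ?] := allP s01 _ ys; have /andP[? ?] := allP s01 _ ys'.
  by apply/andP; split; [exact: le_trans yp|exact: le_trans yp' _].
have [pge0 ple1] := andP p01; have q0 : 0 <= 1 - p by rewrite subr_ge0.
apply: (@le_trans _ _ (pbEe s (EFin \o (fun k => 2 * Num.sqrt n%:R * phi k)))).
  apply: le_pbEe => // k kn; rewrite /lik_ratio ifF; last first.
    by apply/negbTE; rewrite mulf_neq0// expf_neq0.
  rewrite lee_fin /phi mulrA ler_wpM2r//.
    by rewrite invr_ge0 mulr_ge0// exprn_ge0.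
  have := @max_likelihood_le_KT R k (n - k); rewrite subnKC//; exact.
rewrite pbEe_EFin lee_fin pbEZ -[leRHS]mulr1 ler_wpM2l ?(le_trans ler01 ge1)//.
(* The convexity of [phi] that Hoeffding's comparison asks for is [KT_convex] at [p^-1] and
   [(1 - p)^-1]; under the binomial law [phi] has mean 1. *)
apply: (le_trans (pbE_le_binomial R s p phi s01 hs _)).
  move=> k kn; rewrite /phi.
  have [b nE] : exists b, n = (k + b).+2.
    by exists (n - k.+2)%N; rewrite -!addSn subnKC.
  have E0 : (n - k = b.+2)%N by rewrite nE -!addnS addKn.
  have E1 : (n - k.+1 = b.+1)%N by rewrite nE -addSn -addnS addKn.
  have E2 : (n - k.+2 = b)%N by rewrite nE -!addSn addKn.
  rewrite E0 E1 E2.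
  have := ler_wpM2l _ (KT_convex R k b p^-1 (1 - p)^-1).
  move=> /(_ (p ^- k * (1 - p) ^- b)) H.
  rewrite [leLHS](_ : _ = p ^- k * (1 - p) ^- b * (2 * (KT R k.+1 b.+1 / p / (1 - p)))); last first.
    by rewrite !exprS; field; rewrite !expf_neq0 ?p0 ?p1.
  rewrite [leRHS](_ : _ = p ^- k * (1 - p) ^- b *
    (KT R k b.+2 * (1 - p)^-1 ^+ 2 + KT R k.+2 b * p^-1 ^+ 2)); last first.
    by rewrite !exprS !expr0; field; rewrite !expf_neq0 ?p0 ?p1.
  by apply: H; rewrite mulr_ge0 ?invr_ge0 ?exprn_ge0.
rewrite -[leRHS](KT00 R) -(pbE_nseq_KT R p n 0 0 p0 p1).
by rewrite le_eqVlt; apply/orP; left; apply/eqP; apply: eq_pbE.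
Qed.

(** Apply [exprn_le_expR] to [r * p] with exponent [k] and to [t * (1 - p)] with exponent [n - k]:
    the exponential factors cancel. *)
Lemma le_lik_ratio n p k r t : (0 < n)%N -> (k <= n)%N -> 0 <= p <= 1 -> 0 < r -> 0 < t ->
  ((expR (n%:R * (1 - r * p - t * (1 - p))) * (r ^+ k * t ^+ (n - k)))%:E
   <= lik_ratio n p k)%E.
Proof.
move=> n0 kn /andP[p0 p1] r0 t0; rewrite /lik_ratio; case: ifPn => [_|pn0]; first by rewrite leey.
have q0 : 0 <= 1 - p by rewrite subr_ge0.
rewrite lee_fin ler_pdivlMr; last by rewrite lt_def pn0 mulr_ge0// exprn_ge0.
have hu := exprn_le_expR R n k (r * p) n0 (mulr_ge0 (ltW r0) p0).
have hv := exprn_le_expR R n (n - k) (t * (1 - p)) n0 (mulr_ge0 (ltW t0) q0).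
have rp0 : 0 <= (r * p) ^+ k by rewrite exprn_ge0// mulr_ge0// ltW.
have tp0 : 0 <= (t * (1 - p)) ^+ (n - k) by rewrite exprn_ge0// mulr_ge0// ltW.
have := ler_wpM2l (expR_ge0 (n%:R * (1 - r * p - t * (1 - p)))) (ler_pM rp0 tp0 hu hv).
rewrite (exprMn k r p) (exprMn (n - k) t (1 - p)).
move=> H; rewrite -mulrA [X in _ * X <= _]mulrACA; apply: (le_trans H).
rewrite [X in _ * X <= _]mulrACA [X in X <= _]mulrCA -!expRD [X in expR X](_ : _ = 0) ?expR0 ?mulr1//.
by rewrite natrB//; ring.
Qed.

(** [weighted_AMGM] on each entry gives a product, which [pbE_geom] reads as a mean of
    [r ^+ k * t ^+ (size s - k)]; [le_lik_ratio] then removes [r] and [t]. *)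
Lemma expR_le_pbEe_lik_ratio s p r t : (0 < size s)%N -> all (fun x => 0 <= x <= 1) s ->
  0 <= p <= 1 -> 0 < r -> 0 < t ->
  ((expR (\sum_(x <- s) (x * ln r + (1 - x) * ln t)
          + (size s)%:R * (1 - r * p - t * (1 - p))))%:E
   <= pbEe s (lik_ratio (size s) p))%E.
Proof.
move=> s0 s01 p01 r0 t0; rewrite expRD expR_sum.
set C := expR _.
apply: (@le_trans _ _ (C * \prod_(x <- s) (x * r + (1 - x) * t))%:E).
  rewrite lee_fin mulrC ler_wpM2l ?expR_ge0//.
  rewrite big_seq [leRHS]big_seq; apply: ler_prod => x xs.
  by rewrite expR_ge0/= weighted_AMGM// (allP s01 _ xs).
rewrite -pbE_geom -pbEZ -pbEe_EFin; apply: le_pbEe => // k ks.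
exact: le_lik_ratio.
Qed.

End likelihood_ratio.

(** * Factorisation of integrals, from indicators to nonnegative functions *)

Section independence_integral.
Local Open Scope ereal_scope.
Context {R : realType}.
Import HBNNSimple.

(** The bound [u n <= l] serves the case [y = +oo]: if [l = 0] it forces [u n = 0], and otherwise
    the products are eventually [+oo]. *)
Lemma cvge_nnZr (u : nat -> R) (l : R) (y : \bar R) :
  (forall n, 0 <= u n <= l)%R -> (u n)%:E @[n --> \oo] --> l%:E -> 0 <= y ->
  (u n)%:E * y @[n --> \oo] --> l%:E * y.
Proof.
move=> u0l ul; case: y => [y y0|_|//]; first exact: cvgeZr.
have [l0|l0] := eqVneq l 0%R.
  have uE n : u n = 0%R by apply/eqP; rewrite eq_le; have := u0l n; rewrite l0 andbC.
  rewrite l0; under eq_fun do rewrite uE.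
  exact: cvg_cst.
have lgt0 : (0 < l)%R by rewrite lt_def l0 /=; have /andP[/le_trans h1 /h1] := u0l 0%N.
rewrite gt0_muley ?lte_fin//.
apply: cvg_near_cst.
have : \forall n \near \oo, (0 < u n)%R.
  move/fine_cvgP : ul => [_] /=.
  by move=> /cvgr_gt; apply.
by apply: filterS => n un; rewrite gt0_muley ?lte_fin.
Qed.

Lemma integral_nnsfun_approxM d1 d2 (X : measurableType d1) (Z : measurableType d2)
  (mu : {measure set X -> \bar R}) (f : X -> Z) (Y : X -> \bar R) (g : Z -> R)
  (mg : measurable_fun [set: Z] (fun z => (g z)%:E)) :
  measurable_fun setT f -> measurable_fun setT Y -> (forall x, 0 <= Y x) ->
  (forall z, 0 <= g z)%R ->
  \int[mu]_x ((g (f x))%:E * Y x) =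
  limn (fun n => \int[mu]_x ((nnsfun_approx measurableT mg n (f x))%:E * Y x)).
Proof.
move=> mf mY Y0 g0; set h := nnsfun_approx _ _.
have hg z : (h n z)%:E @[n --> \oo] --> (g z)%:E.
  by apply: (cvg_nnsfun_approx measurableT mg) => // y _; rewrite lee_fin.
have hnd z : nondecreasing_seq (fun n => (h n z)%:E).
  by move=> a b ab; rewrite lee_fin; exact/lefP/nd_nnsfun_approx.
have hle n z : (0 <= h n z <= g z)%R.
  rewrite fun_ge0 /= -lee_fin nnsfun_approxE.
  by apply: (@le_approx _ _ _ _ (fun z => (g z)%:E)) => // y _; rewrite lee_fin.
rewrite -monotone_convergence//.
- apply: eq_integral => x _; apply/esym/cvg_lim => //.
  by apply: (cvge_nnZr (fun n => h n (f x))) => //.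
- move=> n; apply: emeasurable_funM => //.
  by apply/measurable_EFinP; exact: measurableT_comp.
- by move=> n x _; rewrite mule_ge0// lee_fin.
- by move=> x _ a b ab; rewrite lee_wpmul2r//; exact: hnd.
Qed.

Lemma integral_nnsfunM d1 d2 (X : measurableType d1) (Z : measurableType d2)
  (mu : {measure set X -> \bar R}) (f : X -> Z) (Y : X -> \bar R) (h : {nnsfun Z >-> R}) :
  measurable_fun setT f -> measurable_fun setT Y -> (forall x, 0 <= Y x) ->
  \int[mu]_x ((h (f x))%:E * Y x) =
  \sum_(r \in range h) r%:E * \int[mu]_x ((\1_(h @^-1` [set r]) (f x))%:E * Y x).
Proof.
move=> mf mY Y0.
have mind r : measurable_fun setT (fun x => (\1_(h @^-1` [set r]) (f x))%:E * Y x).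
  apply: emeasurable_funM => //; apply/measurable_EFinP.
  exact: measurableT_comp.
transitivity (\int[mu]_x \sum_(r \in range h) (r%:E * ((\1_(h @^-1` [set r]) (f x))%:E * Y x))).
  apply: eq_integral => x _; rewrite fimfunE -fsumEFin// ge0_mule_fsuml.
    by apply: eq_fsbigr => r _; rewrite EFinM muleA.
  by move=> r; exact: nnfun_muleindic_ge0.
have nn r x : 0 <= r%:E * ((\1_(h @^-1` [set r]) (f x))%:E * Y x).
  by rewrite muleA mule_ge0// -EFinM; exact: nnfun_muleindic_ge0.
rewrite ge0_integral_fsum//; last first.
  by move=> r; apply: measurable_funeM.
apply: eq_fsbigr => r; rewrite inE => -[z _ <-].
rewrite ge0_integralZl ?lee_fin//.
by move=> x _; rewrite mule_ge0// lee_fin.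
Qed.

(** The last hypothesis says that [f] has law [c] times [nu] under the measure of density [Y]. It
    extends to simple functions by linearity and to [g] by monotone convergence. *)
Lemma integral_indep_mul d1 d2 (X : measurableType d1) (Z : measurableType d2)
  (mu : {measure set X -> \bar R}) (nu : {measure set Z -> \bar R})
  (f : X -> Z) (Y : X -> \bar R) (c : \bar R) (g : Z -> R) :
  measurable_fun setT f -> measurable_fun setT Y -> (forall x, 0 <= Y x) ->
  0 <= c -> measurable_fun setT g -> (forall z, 0 <= g z)%R ->
  (forall B, measurable B -> \int[mu]_x ((\1_B (f x))%:E * Y x) = nu B * c) ->
  \int[mu]_x ((g (f x))%:E * Y x) = (\int[nu]_z (g z)%:E) * c.
Proof.
move=> mf mY Y0 c0 mg g0 H.
have mg' : measurable_fun setT (fun z => (g z)%:E) by exact/measurable_EFinP.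
rewrite -ge0_integralZr//; last by move=> z _; rewrite lee_fin.
rewrite (integral_nnsfun_approxM _ _ _ _ mu f Y g mg')//.
(* The right-hand side is an integral of the same shape, with the identity for [f] and a constant
   for [Y], so both sides are approximated alike. *)
rewrite (integral_nnsfun_approxM _ _ _ _ nu idfun (cst c) g mg')//; last exact: measurable_id.
congr (limn _); apply/funext => n.
rewrite (integral_nnsfunM _ _ _ _ mu f)// (integral_nnsfunM _ _ _ _ nu idfun)//; last exact: measurable_id.
apply: eq_fsbigr => r _; congr (_ * _).
rewrite H// ge0_integralZr//.
- by rewrite /= integral_indic// setIT.
- by apply/measurable_EFinP; apply: measurable_indic.
Qed.

End independence_integral.

(** * Expectations over independent samples *)

Lemma integral_probability1 d (X : measurableType d) (R : realType)
  (mu : probability X R) : (\int[mu]_x 1 = 1)%E.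
Proof. by rewrite integral_cst// mul1e; exact: probability_setT. Qed.

Lemma measurable_pbEe (R : realType) d (X : measurableType d) (I : Type)
  (f : I -> X -> R) (phi : nat -> X -> \bar R) (s : seq I) :
  (forall i, measurable_fun setT (f i)) -> (forall k, measurable_fun setT (phi k)) ->
  measurable_fun setT (fun x => pbEe R [seq f i x | i <- s] (phi ^~ x)).
Proof.
move=> mf; elim: s phi => [|i s IH] phi mphi /=; first exact: mphi.
apply: emeasurable_funD; apply: emeasurable_funM.
- exact/measurable_EFinP.
- by apply: (IH (fun k => phi k.+1)) => k; exact: mphi.
- by apply/measurable_EFinP; exact: measurable_funB.
- exact: IH.
Qed.

Section independent_samples.
Local Open Scope ereal_scope.
Context {R : realType} {dO dZ : measure_display} {Omega : measurableType dO}
  {Z : measurableType dZ} (Pr : probability Omega R) {I : finType}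
  (X : I -> Omega -> Z) (D : I -> probability Z R).

Definition indep_samples := (forall i, measurable_fun setT (X i)) /\
  forall B : I -> set Z, (forall i, measurable (B i)) ->
    Pr [set w | forall i, B i (X i w)] = \prod_i D i (B i).

Lemma probability_mean01 (mu : probability Z R) (g : Z -> R) :
  measurable_fun setT g -> (forall z, 0 <= g z <= 1)%R ->
  exists2 p : R, \int[mu]_z (g z)%:E = p%:E & (0 <= p <= 1)%R.
Proof.
move=> mg g01.
have g0 z : (0 <= g z)%R by have /andP[] := g01 z.
have I0 : 0 <= \int[mu]_z (g z)%:E by apply: integral_ge0 => z _; rewrite lee_fin.
have I1 : \int[mu]_z (g z)%:E <= 1.
  rewrite -(integral_probability1 _ Z R mu).
  apply: ge0_le_integral => //.
  - by move=> z _; rewrite lee_fin.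
  - exact/measurable_EFinP.
  - by move=> z _; rewrite lee_fin; have /andP[] := g01 z.
have fI : \int[mu]_z (g z)%:E \is a fin_num.
  by rewrite ge0_fin_numE// (le_lt_trans I1)// ltey.
exists (fine (\int[mu]_z (g z)%:E)); first by rewrite fineK.
by rewrite -!lee_fin fineK// I0.
Qed.

Hypothesis indepX : indep_samples.
Variable g : I -> Z -> R.
Hypothesis mg : forall i, measurable_fun setT (g i).
Hypothesis g01 : forall i z, (0 <= g i z <= 1)%R.
Variable p : I -> R.
Hypothesis pE : forall i, \int[D i]_z (g i z)%:E = (p i)%:E.

Lemma mean01 i : (0 <= p i <= 1)%R.
Proof.
by have [q] := probability_mean01 (D i) _ (mg i) (g01 i); rewrite pE => -[->].
Qed.

Lemma integral_mean_compl i : \int[D i]_z (1 - g i z)%:E = (1 - p i)%:E.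
Proof.
under eq_integral do rewrite EFinB.
rewrite integralB_EFin//=.
- by rewrite pE (integral_probability1 _ Z R (D i)).
- exact: finite_measure_integrable_cst.
- apply: (le_integrable measurableT _ _ (finite_measure_integrable_cst (D i) 1%R measurableT)).
    exact/measurable_EFinP.
  move=> z _ /=; rewrite lee_fin normr1 ger0_norm; first by have /andP[] := g01 i z.
  by have /andP[] := g01 i z.
Qed.

(** The events [B i] carry the induction on [s]: integrating out the sample [k] by
    [integral_indep_mul] requires the identity with an indicator of [X k], which is the induction
    hypothesis for a modified family of events. *)
Lemma integral_indic_pbEe (s : seq I) (B : I -> set Z) (phi : nat -> \bar R) :
  uniq s -> (forall i, measurable (B i)) -> (forall i, i \in s -> B i = setT) ->
  (forall k, 0 <= phi k) ->
  \int[Pr]_w ((\1_[set w | forall i, B i (X i w)] w)%:E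
              * pbEe R [seq g i (X i w) | i <- s] phi)
  = (\prod_i D i (B i)) * pbEe R [seq p i | i <- s] phi.
Proof.
have [mX HX] := indepX.
have mS (C : I -> set Z) : (forall i, measurable (C i)) ->
    measurable [set w | forall i, C i (X i w)].
  move=> mC; rewrite [X in measurable X](_ : _ = \big[setI/setT]_i (X i @^-1` C i)).
    by apply: bigsetI_measurable => i _; rewrite -[_ @^-1` _]setTI; exact: mX.
  apply/seteqP; split => w /=.
    by move=> Cw; elim/big_ind: _ => //= C1 C2 ? ?; split.
  by move=> + i; rewrite (bigD1 i)//= => -[].
have s01 w s' : all (fun x => 0 <= x <= 1)%R [seq g i (X i w) | i <- s'].
  by apply/allP => _ /mapP[i _ ->].
have p01 s' : all (fun x => 0 <= x <= 1)%R [seq p i | i <- s'].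
  by apply/allP => _ /mapP[i _ ->]; exact: mean01.
elim: s B phi => [|k s IH] B phi /=.
  move=> _ mB _ phi0; rewrite ge0_integralZr//.
  - rewrite integral_indic//; last exact: (mS B mB).
    by rewrite setIT; congr (_ * _); exact: (HX B mB).
  - apply/measurable_EFinP. apply: measurable_indic. exact: (mS B).
move=> /andP[ks us] mB BT phi0.
pose S := [set w | forall i, B i (X i w)].
pose Y (psi : nat -> \bar R) w := (\1_S w)%:E * pbEe R [seq g i (X i w) | i <- s] psi.
have Y0 psi : (forall j, 0 <= psi j) -> forall w, 0 <= Y psi w.
  by move=> psi0 w; rewrite mule_ge0 ?lee_fin//; exact: pbEe_ge0.
have mY psi : measurable_fun setT (Y psi).
  apply: emeasurable_funM.
    by apply/measurable_EFinP; apply: measurable_indic; exact: (mS B).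
  apply: (measurable_pbEe R _ _ _ (fun i w => g i (X i w)) (fun k _ => psi k)) => // i.
  exact: measurableT_comp.
have key psi (h : Z -> R) : (forall j, 0 <= psi j) -> measurable_fun setT h ->
    (forall z, 0 <= h z)%R ->
    \int[Pr]_w ((h (X k w))%:E * Y psi w) =
    \int[D k]_z (h z)%:E * ((\prod_i D i (B i)) * pbEe R [seq p i | i <- s] psi).
  move=> psi0 mh h0; apply: integral_indep_mul => //.
  - exact: Y0.
  - by rewrite mule_ge0 ?pbEe_ge0//; apply: prode_ge0.
  - move=> C mC.
    (* Since [B k] is the whole space, the indicator of [C] at [X k] can be absorbed into the event
       by setting its [k]-th component to [C]. *)
    pose B' i := if i == k then C else B i.
    have mB' i : measurable (B' i) by rewrite /B'; case: ifP.
    have B'T i : i \in s -> B' i = setT.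
      move=> is_; rewrite /B' ifF; first by rewrite BT// inE is_ orbT.
      by apply/negbTE; apply: contraNneq ks => <-.
    have := IH B' psi us mB' B'T psi0.
    have -> : \prod_i D i (B' i) = D k C * \prod_(i | i != k) D i (B i).
      rewrite (bigD1 k)//= {1}/B' eqxx; congr (_ * _).
      by apply: eq_bigr => i ik; rewrite /B' (negbTE ik).
    have -> : \prod_i D i (B i) = \prod_(i | i != k) D i (B i).
      by rewrite (bigD1 k)//= [B k]BT ?mem_head// probability_setT mul1e.
    rewrite -muleA.
    move=> IHk; refine (etrans _ IHk).
    apply: eq_integral => w _; rewrite /Y muleA; congr (_ * _).
    rewrite -EFinM; congr EFin; rewrite !indicE -natrM mulnb; congr (_%:R).
    congr nat_of_bool; apply/andP/idP; rewrite !inE.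
      move=> [Cw Sw] i; rewrite /B'; case: eqVneq => [->//|_]; exact: Sw.
    move=> H; split; first by have := H k; rewrite /B' eqxx.
    move=> i; have [->|ik] := eqVneq i k; first by rewrite BT// mem_head.
    by have := H i; rewrite /B' (negbTE ik).
under eq_integral.
  move=> w _; rewrite ge0_muleDr; last 2 first.
  - by rewrite mule_ge0 ?lee_fin ?pbEe_ge0// => [|j]; [have /andP[] := g01 k (X k w)|exact: phi0].
  - by rewrite mule_ge0 ?lee_fin ?subr_ge0 ?pbEe_ge0//; have /andP[] := g01 k (X k w).
  rewrite !(muleCA (\1_ _ _)%:E).
  rewrite -/(Y phi w) -/(Y (phi \o succn) w).
  over.
have mX1 : measurable_fun setT (fun w => g k (X k w)) by exact: measurableT_comp.
have phi0' j : 0 <= (phi \o succn) j by exact: phi0.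
rewrite ge0_integralD//.
- rewrite (key (phi \o succn) (g k))//; last by move=> z; have /andP[] := g01 k z.
  rewrite (key phi (fun z => 1 - g k z)%R)//; last first.
    by move=> z; rewrite subr_ge0; have /andP[] := g01 k z.
    exact: measurable_funB.
  rewrite pE integral_mean_compl !(muleCA (_ %:E)) -ge0_muleDr//.
  + by rewrite mule_ge0 ?lee_fin ?pbEe_ge0//; have /andP[] := mean01 k.
  + by rewrite mule_ge0 ?lee_fin ?subr_ge0 ?pbEe_ge0//; have /andP[] := mean01 k.
- by move=> w _; rewrite mule_ge0 ?lee_fin ?Y0//; have /andP[] := g01 k (X k w).
- by apply: emeasurable_funM => //; exact/measurable_EFinP.
- by move=> w _; rewrite mule_ge0 ?lee_fin ?subr_ge0 ?Y0//; have /andP[] := g01 k (X k w).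
- by apply: emeasurable_funM => //; apply/measurable_EFinP; exact: measurable_funB.
Qed.

Lemma integral_pbEe (phi : nat -> \bar R) : (forall k, 0 <= phi k) ->
  \int[Pr]_w pbEe R [seq g i (X i w) | i <- enum I] phi = pbEe R [seq p i | i <- enum I] phi.
Proof.
move=> phi0.
have := integral_indic_pbEe (enum I) (fun=> setT) phi (enum_uniq _) (fun=> measurableT) (fun _ _ => erefl) phi0.
rewrite big1 => [|i _]; last exact: probability_setT.
rewrite mul1e => <-; apply: eq_integral => w _.
by rewrite indicE mem_set//= mul1e.
Qed.

End independent_samples.

(** * The event of high probability *)

Lemma measurable_lik_ratio (R : realType) d (T : measurableType d) (q : T -> R) n k :
  measurable_fun setT q -> (forall t, 0 <= q t <= 1) ->
  measurable_fun setT (fun t => lik_ratio R n (q t) k).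
Proof.
move=> mq q01; pose u t := q t ^+ k * (1 - q t) ^+ (n - k).
have mu : measurable_fun setT u.
  by apply: measurable_funM; apply: measurable_funX => //; exact: measurable_funB.
pose c : R := (k%:R / n%:R) ^+ k * ((n - k)%:R / n%:R) ^+ (n - k).
rewrite (_ : (fun t => _) =
    (fun t => if u t == 0 then +oo%E else (c * expR (- ln (u t)))%:E)); last first.
  apply/funext => t; rewrite /lik_ratio -/(u t); case: eqVneq => // u0.
  rewrite expRN lnK// posrE lt_def u0 /=.
  have /andP[q0 q1] := q01 t.
  by rewrite mulr_ge0 ?exprn_ge0// subr_ge0.
apply: measurable_fun_ifT => //; first exact: measurable_fun_eqr.
apply/measurable_EFinP; apply: measurable_funM => //.
apply: measurableT_comp; first exact: measurable_expR.
by apply: measurableT_comp => //; apply: measurableT_comp => //; exact: measurable_ln.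
Qed.

Lemma markov_event (R : realType) d (Omega : measurableType d)
  (Pr : probability Omega R) (F : Omega -> \bar R) (b delta : R) :
  measurable_fun setT F -> (forall w, 0 <= F w)%E -> 0 < b -> 0 < delta ->
  (\int[Pr]_w F w <= b%:E)%E ->
  exists E : set Omega, [/\ measurable E, (Pr E >= (1 - delta)%:E)%E &
    forall w, E w -> (F w <= (b / delta)%:E)%E].
Proof.
move=> mF F0 b0 d0 Fb.
pose A := [set w | (b / delta)%:E <= F w]%E.
have mA : measurable A.
  by rewrite /A -[X in measurable X]setTI; exact: emeasurable_fun_c_infty.
exists (~` A); split.
- exact: measurableC.
- rewrite probability_setC// EFinB leeB//.
  have : ((b / delta)%:E * Pr A <= b%:E)%E.
    apply: le_trans Fb.
    apply: (@le_trans _ _ (\int[Pr]_(w in A) F w)%E); last exact: ge0_subset_integral.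
    have <- : (\int[Pr]_(w in A) (b / delta)%:E = (b / delta)%:E * Pr A)%E by exact: integral_cst.
    apply: ge0_le_integral => //.
    + by move=> w _; rewrite lee_fin ltW// divr_gt0.
    + exact: measurable_funTS.
  have fA : Pr A \is a fin_num by exact: fin_num_measure.
  rewrite -(fineK fA) -EFinM !lee_fin mulrAC ler_pdivrMr// mulrC.
  by rewrite [leRHS]mulrC ler_pM2r.
- by move=> w /= /negP; rewrite -ltNge => /ltW.
Qed.

Section sample_event.
Local Open Scope ereal_scope.
Context {R : realType} {dO dZ dT : measure_display} {Omega : measurableType dO}
  {Z : measurableType dZ} {T : measurableType dT}
  (Pr : probability Omega R) {I : finType}
  (X : I -> Omega -> Z) (D : I -> probability Z R) (x : I -> T -> Z -> R) (p : I -> T -> R)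
  (mu : probability T R).
Hypothesis indepX : indep_samples Pr X D.
Hypothesis mx : forall i, measurable_fun setT (fun tz => x i tz.1 tz.2).
Hypothesis x01 : forall i t z, (0 <= x i t z <= 1)%R.
Hypothesis pE : forall i t, \int[D i]_z (x i t z)%:E = (p i t)%:E.
Hypothesis I0 : (0 < #|I|)%N.

Let xw w t := [seq x i t (X i w) | i <- enum I].
Let q t : R := ((\sum_i p i t) / #|I|%:R)%R.
(** The observed losses serve as Bernoulli means: [G w t] averages [lik_ratio] over a random
    rounding of each loss to 0 or 1. *)
Let G w t := pbEe R (xw w t) (lik_ratio R #|I| (q t)).

Lemma measurable_loss i t : measurable_fun setT (x i t).
Proof. exact: measurableT_comp (mx i) (measurable_pair1 t). Qed.

Lemma measurable_mean i : measurable_fun setT (p i).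
Proof.
apply/measurable_EFinP.
rewrite (_ : EFin \o p i = (fun t => \int[D i]_z (x i t z)%:E)).
  apply: (measurable_fun_fubini_tonelli_F (fun tz => (x i tz.1 tz.2)%:E)).
    exact/measurable_EFinP.
  by move=> tz; rewrite lee_fin; have /andP[] := x01 i tz.1 tz.2.
by apply/funext => t; rewrite pE.
Qed.

Lemma mean_loss01 i t : (0 <= p i t <= 1)%R.
Proof.
have [y] := probability_mean01 (D i) _ (measurable_loss i t) (x01 i t).
by rewrite pE => -[->].
Qed.

Lemma average_mean01 t : (0 <= q t <= 1)%R.
Proof.
have cr : (0 < #|I|%:R :> R)%R by rewrite ltr0n.
rewrite /q divr_ge0//=; last by apply: sumr_ge0 => i _; have /andP[] := mean_loss01 i t.
rewrite ler_pdivrMr// mul1r -sum1_card natr_sum; apply: ler_sum => i _.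
by have /andP[] := mean_loss01 i t.
Qed.

Lemma sample01 w t : all (fun y => 0 <= y <= 1)%R (xw w t).
Proof. by apply/allP => _ /mapP[i _ ->]. Qed.

Lemma measurable_average_mean : measurable_fun setT q.
Proof.
apply: measurable_funM => //.
by apply: measurable_sum => i; exact: measurable_mean.
Qed.

Lemma measurable_lik_mean : measurable_fun setT (fun wt => G wt.1 wt.2).
Proof.
apply: (measurable_pbEe R _ _ _ (fun i wt => x i wt.2 (X i wt.1))
   (fun k wt => lik_ratio R #|I| (q wt.2) k)).
  move=> i; have [mX _] := indepX.
  have m1 : measurable_fun setT (fun wt : Omega * T => X i wt.1) by exact: measurableT_comp.
  have m2 : measurable_fun setT (fun wt : Omega * T => wt.2) by exact: measurable_snd.
  exact: (measurableT_comp (mx i) (measurable_fun_pair m2 m1)).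
move=> k; apply: measurable_lik_ratio.
  by apply: measurableT_comp => //; exact: measurable_average_mean.
by move=> wt; exact: average_mean01.
Qed.

Lemma lik_mean_ge0 w t : 0 <= G w t.
Proof.
apply: pbEe_ge0; first exact: sample01.
by move=> k; exact/lik_ratio_ge0/average_mean01.
Qed.

(** For fixed [t], averaging over the sample turns each Bernoulli mean into [p i t], and these have
    average [q t], so [pbEe_lik_ratio_le] applies. *)
Lemma integral_lik_mean_le t : \int[Pr]_w G w t <= (2 * Num.sqrt #|I|%:R)%:E.
Proof.
rewrite (integral_pbEe Pr X D indepX (x^~ t) (fun i => measurable_loss i t) (fun i => x01 i t) (p^~ t) (pE^~ t)); last first.
  by move=> k; exact/lik_ratio_ge0/average_mean01.
have szp : size [seq p i t | i <- enum I] = #|I| by rewrite size_map -cardE.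
rewrite -szp; apply: pbEe_lik_ratio_le.
- by rewrite szp.
- by apply/allP => _ /mapP[i _ ->]; exact: mean_loss01.
- rewrite szp big_map big_enum /= /q mulrC divfK//.
  by rewrite pnatr_eq0 -lt0n.
Qed.

(** Markov's inequality for the [mu]-mean of [G]. As [G] dominates the integrand for every [r] and
    [s], they may be chosen after the event. *)
Lemma sample_event (delta : R) : (0 < delta)%R ->
  exists E : set Omega, [/\ measurable E, Pr E >= (1 - delta)%:E &
    forall w, E w -> forall r s : R, (0 < r)%R -> (0 < s)%R ->
    \int[mu]_t (expR (\sum_i (x i t (X i w) * ln r + (1 - x i t (X i w)) * ln s)
          + #|I|%:R * (1 - r * q t - s * (1 - q t))))%:E
      <= (2 * Num.sqrt #|I|%:R / delta)%:E].
Proof.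
move=> d0.
have b0 : (0 < 2 * Num.sqrt #|I|%:R :> R)%R by rewrite mulr_gt0// sqrtr_gt0 ltr0n.
have [|||E [mE PE HE]] := markov_event R _ Omega Pr (fun w => \int[mu]_t G w t) _ delta _ _ b0 d0.
- by apply: (measurable_fun_fubini_tonelli_F (fun wt => G wt.1 wt.2)) => [|wt]; [exact: measurable_lik_mean|exact: lik_mean_ge0].
- by move=> w; apply: integral_ge0 => t _; exact: lik_mean_ge0.
(* The sample is integrated first, because the bound on [G] is available for fixed [t]. *)
- rewrite (fubini_tonelli (fun wt => G wt.1 wt.2))/=; last 2 first.
  + exact: measurable_lik_mean.
  + by move=> wt; exact: lik_mean_ge0.
  rewrite -[leRHS]mul1e -(@integral_probability1 _ T R mu) -ge0_integralZr//.
    apply: ge0_le_integral => //.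
    + by move=> t _; apply: integral_ge0 => w _; exact: lik_mean_ge0.
    + by apply: (measurable_fun_fubini_tonelli_G (fun wt => G wt.1 wt.2)) => [|wt]; [exact: measurable_lik_mean|exact: lik_mean_ge0].
    + by move=> t _; rewrite mul1e; exact: integral_lik_mean_le.

exists E; split => // w Ew r s r0 s0; apply: le_trans (HE w Ew).
have szx t : size (xw w t) = #|I| by rewrite size_map -cardE.
apply: ge0_le_integral => //.
- apply/measurable_EFinP; apply: measurableT_comp; first exact: measurable_expR.
  apply: measurable_funD.
    apply: measurable_sum => i.
    have mxi : measurable_fun setT (fun t => x i t (X i w)).
      exact: measurableT_comp (mx i) (measurable_pair2 (X i w)).
    apply: measurable_funD; apply: measurable_funM => //.
    exact: measurable_funB.
  have mq := measurable_average_mean.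
  apply: measurable_funM => //; apply: measurable_funB.
    by apply: measurable_funB => //; exact: measurable_funM.
  by apply: measurable_funM => //; exact: measurable_funB.
- by apply: measurableT_comp measurable_lik_mean (measurable_pair1 _).
- move=> t _; rewrite /G -(szx t).
  apply: le_trans (expR_le_pbEe_lik_ratio R _ _ r s _ (sample01 w t) (average_mean01 t) r0 s0).
    by rewrite big_map big_enum.
  by rewrite szx.
Qed.

End sample_event.

(** * Donsker-Varadhan change of measure *)

(** Integrability is not assumed, because [f * ln f] in the divergence may have integral [+oo];
    positive and negative parts are compared separately. *)
Lemma ge_integral_of_le (R : realType) d (T : measurableType d)
  (mu : {measure set T -> \bar R}) (f g : T -> \bar R) :
  measurable_fun setT f -> measurable_fun setT g -> (forall x, f x <= g x)%E ->
  (\int[mu]_x f x <= \int[mu]_x g x)%E.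
Proof.
move=> mf mg fg; rewrite integralE [leRHS]integralE; apply: leeB.
- apply: ge0_le_integral.
  + exact: measurableT.
  + by move=> x _; exact: funepos_ge0.
  + exact: (measurable_funepos mf).
  + exact: (measurable_funepos mg).
  + by move=> x _; rewrite !funeposE ge_max !le_max fg lexx orbT.
- apply: ge0_le_integral.
  + exact: measurableT.
  + by move=> x _; exact: funeneg_ge0.
  + exact: (measurable_funeneg mg).
  + exact: (measurable_funeneg mf).
  + by move=> x _; rewrite !funenegE ge_max !le_max leeN2 fg lexx orbT.
Qed.

(* Donsker-Varadhan, from the Fenchel-Young inequality
   [f h <= f ln f - f + exp h] integrated against [nu]. *)
Lemma Donsker_Varadhan (R : realType) d (T : measurableType d)
  (mu nu : probability T R) (h : T -> R) (C : R) :
  measurable_fun setT h -> [bounded h x | x in setT] ->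
  (\int[nu]_x (expR (h x))%:E <= (expR C)%:E)%E ->
  (\int[mu]_x (h x)%:E <= KL mu nu + C%:E)%E.
Proof.
move=> mh bh hC; rewrite /KL; case: pselect => [dom|ndom] /=; last by rewrite addye ?leey.
have dom' : mu `<< nu by [].
(* This version of the density is nonnegative and finite everywhere, and it agrees almost everywhere
   with the one in [KL]. *)
set f0 := Radon_Nikodym_SigmaFinite.f mu nu.
have f00 x : (0 <= f0 x)%E by exact: Radon_Nikodym_SigmaFinite.f_ge0.
have f0fin x : f0 x \is a fin_num by exact: Radon_Nikodym_SigmaFinite.f_fin_num.
pose f x := fine (f0 x).
have f0E x : f0 x = (f x)%:E by rewrite fineK.
have f_ge0 x : 0 <= f x by rewrite -lee_fin -f0E.
have if0 : nu.-integrable setT f0 by exact: Radon_Nikodym_SigmaFinite.f_integrable.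
have mf : measurable_fun setT f.
  by apply/measurable_EFinP; apply: eq_measurable_fun (measurable_int _ if0) => x _; rewrite f0E.
pose g x := fine (Radon_Nikodym (charge_of_finite_measure mu) nu x).
have mln (k : T -> R) : measurable_fun setT k -> measurable_fun setT (fun x => (k x * ln (k x))%:E).
  move=> mk; apply/measurable_EFinP; apply: measurable_funM => //.
  by apply: measurableT_comp => //; exact: measurable_ln.
have mRN := measurable_int _ (Radon_Nikodym_integrable dom).
have mg : measurable_fun setT g.
  exact: (measurableT_comp (@fine_measurable R _ measurableT) mRN).
have -> : (\int[nu]_x (g x * ln (g x))%:E = \int[nu]_x (f x * ln (f x))%:E)%E.
  apply: ae_eq_integral => //; [exact: mln|exact: mln|].
  apply: (ae_eq_comp (fun y : \bar R => (fine y * ln (fine y))%:E)).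
  exact/ae_eq_sym/ae_eq_Radon_Nikodym_SigmaFinite.
(* Fenchel-Young at [h - C] reads [k * f - expR (h - C) <= f * ln f]; the shift by [C] makes the
   exponential integrate to at most 1, which offsets the [+ 1]. *)
pose k x := h x - C + 1.
have mk : measurable_fun setT k.
  by apply: measurable_funD => //; exact: measurable_funB.
have bk : [bounded k x | x in setT].
  have [M [Mr HM]] := bh; exists (M + `|C| + 1); split; first exact: num_real.
  move=> y yM x _; rewrite /k /=.
  have hM : `|h x| <= y - `|C| - 1 by apply: HM => //; lra.
  have := ler_normD (h x - C) 1; have := ler_normB (h x) C; rewrite normr1; lra.
have ik : mu.-integrable setT (EFin \o k).
  by apply: measurable_bounded_integrable => //; rewrite ltey_eq fin_num_measure.
have ikf : nu.-integrable setT (fun x => (k x * f x)%:E).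
  rewrite (_ : (fun x => _) = (EFin \o k) \* f0)%E; last first.
    by apply/funext => x; rewrite /= f0E.
  exact: (integrableMr measurableT mk bk if0).
have kfE : (\int[nu]_x (k x * f x)%:E = \int[mu]_x (k x)%:E)%E.
  rewrite -(Radon_Nikodym_change_of_variables dom' measurableT ik).
  apply: ae_eq_integral => //.
  - exact: measurable_int _ ikf.
  - apply: emeasurable_funM; first exact: measurable_int _ ik.
    exact: mRN.
  - rewrite (_ : (fun x => _) = (EFin \o k) \* f0)%E; last first.
      by apply/funext => x; rewrite /= f0E.
    exact/ae_eqe_mul2l/ae_eq_Radon_Nikodym_SigmaFinite.
have ie : nu.-integrable setT (fun x => (expR (h x - C))%:E).
  have me : measurable_fun setT (fun x => expR (h x - C)).
    by apply: measurableT_comp; [exact: measurable_expR|exact: measurable_funB].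
  apply: measurable_bounded_integrable => //; first by rewrite ltey_eq fin_num_measure.
  have [M [Mr HM]] := bh; exists (expR (M + 1 - C)); split; first exact: num_real.
  move=> y yM x _; rewrite /= ger0_norm ?expR_ge0//; apply: ltW; apply: le_lt_trans yM.
  rewrite ler_expR lerD2r; apply: le_trans (ler_norm _) _; apply: HM => //; lra.
have eE : (\int[nu]_x (expR (h x - C))%:E <= 1%:E)%E.
  under eq_integral do rewrite expRD EFinM.
  rewrite ge0_integralZr//.
  - have := lee_wpmul2r _ hC; move=> /(_ (expR (- C))%:E).
    by rewrite lee_fin expR_ge0 -EFinM -expRD subrr expR0; exact.
  - by apply/measurable_EFinP; apply: measurableT_comp => //; exact: measurable_expR.
have ih : mu.-integrable setT (EFin \o h).
  by apply: measurable_bounded_integrable => //; rewrite ltey_eq fin_num_measure.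
have kE : (\int[mu]_x (k x)%:E = \int[mu]_x (h x)%:E + (1 - C)%:E)%E.
  rewrite (_ : (fun x : T => (k x)%:E) = (EFin \o h) \+ (EFin \o cst (1 - C)%R))%E; last first.
    by apply/funext => x; rewrite /= -EFinD; congr EFin; rewrite /k; ring.
  rewrite integralD_EFin//; last exact: finite_measure_integrable_cst.
  congr (_ + _)%E.
  transitivity ((1 - C)%:E * mu setT)%E; first by rewrite -integral_cst.
  by rewrite probability_setT mule1.
have ihfin : (\int[mu]_x (h x)%:E)%E \is a fin_num by exact: integrable_fin_num.
have psiE : (\int[mu]_x (h x)%:E - C%:E <=
    \int[nu]_x ((k x * f x)%:E - (expR (h x - C))%:E))%E.
  rewrite integralB_EFin// kfE kE EFinB addeA.
  apply: (@le_trans _ _ (\int[mu]_x (h x)%:E + 1%:E - C%:E - 1%:E)%E).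
    by rewrite -(fineK ihfin) -EFinD -!EFinB lee_fin; lra.
  by apply: leeB.
rewrite -leeBlDr//; apply: le_trans psiE _; apply: ge_integral_of_le.
- apply: emeasurable_funB; first exact: measurable_int _ ikf.
  exact: measurable_int _ ie.
- exact: mln.
move=> x; rewrite -EFinB lee_fin.
have e0 := expR_gt0 (h x - C).
have [fx0|fxn0] := eqVneq (f x) 0; first by rewrite fx0 mulr0 mul0r sub0r oppr_le0 ltW.
have fx0 : 0 < f x by rewrite lt_def fxn0 f_ge0.
(* Multiplying [1 + y <= expR y] at [y = h - C - ln f] by [f] gives the pointwise inequality. *)
have := expR_ge1Dx (h x - C - ln (f x)); rewrite expRD expRN lnK ?posrE//.
move=> /(ler_wpM2l (f_ge0 x)); rewrite mulrCA divff// mulr1 /k; lra.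
Qed.

(** * Variational form of the binary divergence *)

(** For positive [q] and [p] the optimum [r = q / p] gives [kl_term] exactly; if [q = 0] or [p = 0]
    the supremum is only approached, as [r] tends to 0 or to infinity. *)
Lemma kl_term_approx (R : realType) (q p K : R) : 0 <= q -> 0 <= p ->
  (K%:E < kl_term q p)%E -> exists2 r, 0 < r & K <= q * ln r + q - r * p.
Proof.
rewrite /kl_term => q0 p0; have [->|qn0] := eqVneq q 0.
  (* Here [K < 0] and [r * p <= - K] is wanted; the added 1 keeps the quotient meaningful at
     [p = 0]. *)
  rewrite lte_fin => K0; exists (- K / (p + 1)).
    by rewrite divr_gt0 ?oppr_gt0// ltr_wpDl.
  rewrite mul0r !add0r -subr_ge0 [leRHS](_ : _ = - K / (p + 1)).
    by rewrite divr_ge0 ?oppr_ge0 ?ltW// ltr_wpDl.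
  by field; rewrite gt_eqF// ltr_wpDl.
have qgt0 : 0 < q by rewrite lt_def qn0.
have [->|pn0] := eqVneq p 0.
  move=> _; exists (expR (K / q)); first exact: expR_gt0.
  by rewrite expRK mulr0 subr0 mulrCA divff// mulr1 lerDl.
rewrite lte_fin => /ltW KE; exists (q / p).
  by rewrite divr_gt0// lt_def pn0.
by rewrite divfK// addrK.
Qed.

Lemma kl_term_gtNy (R : realType) (q p : R) : (-oo < kl_term q p)%E.
Proof. by rewrite /kl_term; case: ifP => // _; case: ifP => // _; rewrite ltNyr. Qed.

(* [kl q p] is the supremum over [r, s > 0] of functions affine in [(q, p)]. *)
Lemma kl_le_of_affine (R : realType) (q p : R) (A : \bar R) :
  0 <= q <= 1 -> 0 <= p <= 1 ->
  (forall r s : R, 0 < r -> 0 < s ->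
    ((q * ln r + (1 - q) * ln s + 1 - r * p - s * (1 - p))%:E <= A)%E) ->
  (kl q p <= A)%E.
Proof.
move=> /andP[q0 q1] /andP[p0 p1] H; rewrite leNgt; apply/negP; rewrite /kl => Alt.
(* Either term may be [+oo], so the strict inequality is first split into real lower bounds for the
   two terms. *)
have [K1 [K2 [h1 h2 h12]]] : exists K1 K2 : R, [/\ (K1%:E < kl_term q p)%E,
    (K2%:E < kl_term (1 - q) (1 - p))%E & (A < (K1 + K2)%:E)%E].
  have := kl_term_gtNy R (1 - q) (1 - p); have := kl_term_gtNy R q p.
  case: A Alt {H} => [a| |]; last 1 first.
  - move: (kl_term q p) (kl_term (1 - q) (1 - p)) => [x| |] [y| |]//= _ _ _.
    + by exists (x - 1), (y - 1); rewrite !lte_fin ltNyr; split => //; lra.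
    + by exists (x - 1), 0; rewrite !lte_fin ltNyr ltry; split => //; lra.
    + by exists 0, (y - 1); rewrite !lte_fin ltNyr ltry; split => //; lra.
    + by exists 0, 0; rewrite ltNyr !ltry.
  - move: (kl_term q p) (kl_term (1 - q) (1 - p)) => [x| |] [y| |]//=.
    + rewrite -EFinD lte_fin => axy _ _.
      exists (x - (x + y - a) / 3), (y - (x + y - a) / 3).
      by rewrite !lte_fin; split; lra.
    + move=> _ _ _; exists (x - 1), (a - x + 2).
      by rewrite !lte_fin ltry; split => //; lra.
    + move=> _ _ _; exists (a - y + 2), (y - 1).
      by rewrite !lte_fin ltry; split => //; lra.
    + move=> _ _ _; exists a, 1.
      by rewrite !lte_fin !ltry; split => //; lra.
  - by rewrite ltNge leey.
have q0' : 0 <= 1 - q by rewrite subr_ge0.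
have p0' : 0 <= 1 - p by rewrite subr_ge0.
have [r r0 hr] := kl_term_approx R q p K1 q0 p0 h1.
have [s s0 hs] := kl_term_approx R (1 - q) (1 - p) K2 q0' p0' h2.
suff : (A < A)%E by rewrite ltxx.
apply: lt_le_trans h12 (le_trans _ (H r s r0 s0)).
by rewrite lee_fin; lra.
Qed.

(** * Risks of the posteriors as integrals against [frakQ] *)

Section risk_marginals.
Context {R : realType} {dF dZ : measure_display} {F : measurableType dF}
  {Z : measurableType dZ} {n : nat}
  (hQ : probability (pprobability F R) R) (Q : 'I_n -> probability F R)
  (fQ : probability (pprobability F R * n.-tuple F)%type R).
Hypothesis fQ_def : is_frakQ hQ Q fQ.

Let coord (i : 'I_n) (t : (pprobability F R * n.-tuple F)%type) : F := tnth t.2 i.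

Lemma measurable_coord i : measurable_fun setT (coord i).
Proof. exact: measurableT_comp (measurable_tnth i) measurable_snd. Qed.

(** A rectangle constrained in coordinate [i] alone has mass [Q i B], so [Q i] is the law of that
    coordinate. *)
Lemma frakQ_marginal i (g : F -> \bar R) :
  measurable_fun setT g -> (forall f, 0 <= g f)%E ->
  (\int[fQ]_t g (coord i t) = \int[Q i]_f g f)%E.
Proof.
move=> mg g0.
transitivity (\int[pushforward fQ (coord i)]_f g f)%E.
  by rewrite (ge0_integral_pushforward (measurable_coord i)).
apply: eq_measure_integral => [|mphi B mB _]; first exact: measurable_coord.
pose B' j := if j == i then B else setT.
have E : coord i @^-1` B = setT `*` cyl B'.
  apply/seteqP; split => [[P t] /= Bt|[P t] /= [_ /(_ i)]]; last by rewrite /B' eqxx.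
  by split => // j; rewrite /B'; case: eqVneq => [->//|_].
transitivity (fQ (setT `*` cyl B')); first by rewrite -E.
rewrite fQ_def//; last by move=> j; rewrite /B'; case: ifP.
rewrite probability_setT mul1e (bigD1 i)//= {1}/B' eqxx big1 ?mule1// => j ji.
by rewrite /B' (negbTE ji) probability_setT.
Qed.

Variable l : F -> Z -> R.
Hypothesis ml : measurable_fun setT (fun fz => l fz.1 fz.2).
Hypothesis l01 : forall f z, 0 <= l f z <= 1.

Lemma lossQ_frakQ i z0 : (\int[fQ]_t (l (coord i t) z0)%:E = (lossQ l (Q i) z0)%:E)%E.
Proof.
have m1 : measurable_fun setT (fun f => l f z0).
  exact: measurableT_comp ml (measurable_pair2 z0).
rewrite (frakQ_marginal i (fun f => (l f z0)%:E)); last 2 first.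
- exact/measurable_EFinP.
- by move=> f; rewrite lee_fin; have /andP[] := l01 f z0.
have [p pE _] := probability_mean01 (Q i) _ m1 (l01^~ z0).
by rewrite /lossQ pE.
Qed.

(** [risk] averages over hypotheses before data, so Tonelli is used to exchange [D] and [Q i]. *)
Lemma risk_frakQ i (D : probability Z R) :
  (\int[fQ]_t \int[D]_z (l (coord i t) z)%:E = (risk D l (Q i))%:E)%E.
Proof.
have ml' : measurable_fun setT (fun fz : F * Z => (l fz.1 fz.2)%:E) by exact/measurable_EFinP.
have l0' fz : (0 <= (l fz.1 fz.2)%:E)%E.
  by rewrite lee_fin; have /andP[] := l01 fz.1 fz.2.
rewrite (frakQ_marginal i (fun f => \int[D]_z (l f z)%:E)%E); last 2 first.
- exact: (measurable_fun_fubini_tonelli_F (fun fz => (l fz.1 fz.2)%:E) ml' l0').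
- by move=> f; apply: integral_ge0 => z _; exact: (l0' (f, z)).
rewrite (fubini_tonelli (fun fz => (l fz.1 fz.2)%:E) ml' l0')/=.
have lossE z : (\int[Q i]_f (l f z)%:E = (lossQ l (Q i) z)%:E)%E.
  rewrite -lossQ_frakQ (frakQ_marginal i (fun f => (l f z)%:E))//.
    by apply/measurable_EFinP; exact: measurableT_comp ml (measurable_pair2 z).
  by move=> f; exact: (l0' (f, z)).
have loss01 z : 0 <= lossQ l (Q i) z <= 1.
  have m1 : measurable_fun setT (fun f => l f z).
    exact: measurableT_comp ml (measurable_pair2 z).
  have [p pE p01] := probability_mean01 (Q i) _ m1 (l01^~ z).
  by move: (lossE z); rewrite pE => -[<-].
have mloss : measurable_fun setT (lossQ l (Q i)).
  apply/measurable_EFinP; rewrite (_ : EFin \o _ = fun z => \int[Q i]_f (l f z)%:E)%E.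
    exact: (measurable_fun_fubini_tonelli_G (fun fz => (l fz.1 fz.2)%:E) ml' l0').
  by apply/funext => z; rewrite lossE.
under eq_integral do rewrite lossE.
have [p pE _] := probability_mean01 D _ mloss loss01.
by rewrite /risk pE.
Qed.

End risk_marginals.

(** * Flattening of the double index, and integrals of affine functionals *)

Lemma indep_samples_sig (R : realType) dO (Omega : measurableType dO) dZ (Z : measurableType dZ)
  (Pr : probability Omega R) (n : nat) (m : 'I_n -> nat) (D : 'I_n -> probability Z R)
  (z : forall i : 'I_n, 'I_(m i) -> Omega -> Z) :
  iid_samples Pr D z ->
  indep_samples Pr (fun k : {i : 'I_n & 'I_(m i)} => z (tag k) (tagged k)) (fun k => D (tag k)).
Proof.
move=> [mz Hz]; split => [k|B mB]; first exact: mz.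
have := Hz (fun i j => B (Tagged (fun i => 'I_(m i)) j)) (fun i j => mB _).
rewrite (sig_big_dep _ _ (fun i j => D i (B (Tagged (fun i => 'I_(m i)) j)))).
have -> : [set w | forall i j, B (Tagged (fun i => 'I_(m i)) j) (z i j w)] =
    [set w | forall k : {i : 'I_n & 'I_(m i)}, B k (z (tag k) (tagged k) w)].
  apply/seteqP; split => w /= H; first by case=> i j; exact: H.
  by move=> i j; exact: (H (Tagged (fun i => 'I_(m i)) j)).
by move=> ->; apply: eq_bigr => -[].
Qed.
Section affine_functional.
Context {R : realType} {dT : measure_display} {T : measurableType dT} {I : finType}.
Variables (mu : probability T R) (u v : I -> T -> R) (ubar vbar : I -> R).
Hypothesis mu_ : forall i, measurable_fun setT (u i).
Hypothesis mv_ : forall i, measurable_fun setT (v i).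
Hypothesis u01 : forall i t, 0 <= u i t <= 1.
Hypothesis v01 : forall i t, 0 <= v i t <= 1.
Hypothesis uE : forall i, (\int[mu]_t (u i t)%:E = (ubar i)%:E)%E.
Hypothesis vE : forall i, (\int[mu]_t (v i t)%:E = (vbar i)%:E)%E.

Let aff (a b c : R) t := \sum_i (a * u i t + b * v i t + c).

Lemma aff_bounded a b c : [bounded aff a b c t | t in setT].
Proof.
exists (\sum_(i : I) (`|a| + `|b| + `|c|)); split; first exact: num_real.
move=> y yM t _; apply: ltW; apply: le_lt_trans yM => /=.
apply: le_trans (ler_norm_sum _ _ _) _; apply: ler_sum => i _.
have /andP[u0 u1] := u01 i t; have /andP[v0 v1] := v01 i t.
apply: le_trans (ler_normD _ _) _; rewrite lerD2r.
apply: le_trans (ler_normD _ _) _; rewrite !normrM (ger0_norm u0) (ger0_norm v0).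
by apply: lerD; rewrite ler_piMr.
Qed.

Lemma aff_measurable a b c : measurable_fun setT (aff a b c).
Proof.
apply: measurable_sum => i.
by apply: measurable_funD => //; apply: measurable_funD; exact: measurable_funM.
Qed.

Lemma integral_aff a b c :
  (\int[mu]_t (aff a b c t)%:E = (\sum_i (a * ubar i + b * vbar i + c))%:E)%E.
Proof.
have int01 (g : T -> R) : measurable_fun setT g -> (forall t, 0 <= g t <= 1) ->
    mu.-integrable setT (EFin \o g).
  move=> mg g01; apply: measurable_bounded_integrable => //.
    by rewrite ltey_eq fin_num_measure.
  exists 1; split; first exact: num_real.
  move=> y y1 t _; apply: ltW; apply: le_lt_trans y1 => /=.
  by have /andP[g0 g1] := g01 t; rewrite ger0_norm.
under eq_integral do rewrite -sumEFin.
have iau i : mu.-integrable setT (fun t => a%:E * (u i t)%:E)%E.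
  by apply: integrableZl => //; exact: int01.
have ibv i : mu.-integrable setT (fun t => b%:E * (v i t)%:E)%E.
  by apply: integrableZl => //; exact: int01.
have ic : mu.-integrable setT (EFin \o cst c) by exact: finite_measure_integrable_cst.
rewrite integral_sum//.
  rewrite -sumEFin; apply: eq_bigr => i _.
  under eq_integral do rewrite !EFinD !EFinM.
  rewrite integralD//; last exact: integrableD.
  rewrite integralD// integralZl//; last exact: int01.
  rewrite integralZl//; last exact: int01.
  have -> : (\int[mu]_t c%:E = c%:E)%E.
    transitivity (c%:E * mu setT)%E; first by rewrite -integral_cst.
    by rewrite probability_setT mule1.
  by rewrite uE vE !EFinD !EFinM.
move=> i; under eq_fun do rewrite !EFinD !EFinM.
by apply: integrableD => //; exact: integrableD.
Qed.

End affine_functional.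

(** * The bound, from the affine minorants of [kl] averaged over [frakQ] *)

Theorem theorem5 (R : realType)
  (dF : measure_display) (F : measurableType dF)
  (dZ : measure_display) (Z : measurableType dZ)
  (dO : measure_display) (Omega : measurableType dO) (Pr : probability Omega R)
  (n : nat) (n_gt0 : (0 < n)%N)
  (m : 'I_n -> nat) (m_ge1 : forall i, (1 <= m i)%N)
  (D : 'I_n -> probability Z R)
  (l : 'I_n -> F -> Z -> R)
  (l_meas : forall i, measurable_fun [set: (F * Z)%type] (fun fz => l i fz.1 fz.2))
  (l_01 : forall i f z, 0 <= l i f z <= 1)
  (z : forall i : 'I_n, 'I_(m i) -> Omega -> Z)
  (z_iid : iid_samples Pr D z)
  (hP : probability (pprobability F R) R)
  (frakP : probability (pprobability F R * n.-tuple F)%type R)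
  (frakP_def : is_frakP hP frakP)
  (delta : R) (delta_gt0 : 0 < delta) :
  let M := (\sum_(i < n) m i)%N in
  exists E : set Omega,
    [/\ measurable E, (Pr E >= (1 - delta)%:E)%E &
      forall w, E w ->
      forall (hQ : probability (pprobability F R) R) (Q : 'I_n -> probability F R)
             (frakQ : probability (pprobability F R * n.-tuple F)%type R),
        is_frakQ hQ Q frakQ ->
        let RS := \sum_(i < n) ((m i)%:R / M%:R) * risk (D i) (l i) (Q i) in
        let hRS := \sum_(i < n) ((m i)%:R / M%:R) *
                     emp_risk (l i) (Q i) (fun j => z i j w) in
        (kl hRS RS <=
           (KL frakQ frakP + (ln (2 * Num.sqrt (M%:R) / delta))%:E) * (M%:R^-1)%:E)%E].
Proof.
move=> M.
(* One index per sample: the weights [m i / M] of the tasks become uniform weights over the [M]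
   samples. *)
pose I : finType := {i : 'I_n & 'I_(m i)}.
have sumI (G : forall i : 'I_n, 'I_(m i) -> R) :
    \sum_(k : I) G (tag k) (tagged k) = \sum_i \sum_j G i j.
  by rewrite (sig_big_dep _ _ G).
have cardI : #|I| = M.
  rewrite /M -sum1_card; transitivity (\sum_(i < n) \sum_(j < m i) 1)%N.
    by rewrite (sig_big_dep _ _ (fun i (j : 'I_(m i)) => 1%N)).
  by apply: eq_bigr => i _; rewrite sum1_card card_ord.
have I0 : (0 < #|I|)%N.
  by rewrite cardI /M (bigD1 (Ordinal n_gt0))//= addn_gt0 m_ge1.
pose T := (pprobability F R * n.-tuple F)%type.
pose X (k : I) := z (tag k) (tagged k).
pose x (k : I) (t : T) zz := l (tag k) (tnth t.2 (tag k)) zz.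
pose p (k : I) (t : T) := fine (\int[D (tag k)]_zz (x k t zz)%:E).
have mx (k : I) : measurable_fun setT (fun tz : T * Z => x k tz.1 tz.2).
  have m1 : measurable_fun setT (fun tz : T * Z => tnth tz.1.2 (tag k)).
    exact: measurableT_comp (measurable_coord (tag k)) measurable_fst.
  exact: measurableT_comp (l_meas (tag k)) (measurable_fun_pair m1 measurable_snd).
have x01 (k : I) t zz : 0 <= x k t zz <= 1 by exact: l_01.
have mxt k t : measurable_fun setT (x k t).
  exact: measurableT_comp (mx k) (measurable_pair1 t).
have pE k t : (\int[D (tag k)]_zz (x k t zz)%:E = (p k t)%:E)%E.
  by have [y yE _] := probability_mean01 (D (tag k)) _ (mxt k t) (x01 k t); rewrite /p yE.
have p01 k t : 0 <= p k t <= 1.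
  by have [y yE y01] := probability_mean01 (D (tag k)) _ (mxt k t) (x01 k t); rewrite /p yE.
(* The event is built from [frakP] alone, before any posterior or any [r], [s] is introduced. *)
have [E [mE PE HE]] := sample_event Pr X (fun k => D (tag k)) x p frakP
  (indep_samples_sig _ _ _ _ _ _ _ _ _ _ z_iid) mx x01 pE I0 delta delta_gt0.
exists E; split => // w Ew hQ Q frakQ HQ; cbv zeta.
set hRS := (X in kl X _); set RS := (X in kl _ X).
have M0 : 0 < M%:R :> R by rewrite ltr0n -cardI.
have Mn0 : M%:R != 0 :> R by rewrite gt_eqF.
have mn0 i : (m i)%:R != 0 :> R by rewrite pnatr_eq0 -lt0n m_ge1.
have mX0 k : measurable_fun setT (fun t => x k t (X k w)).
  exact: measurableT_comp (mx k) (measurable_pair2 (X k w)).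
have mp k : measurable_fun setT (p k) := measurable_mean (fun k => D (tag k)) x p mx x01 pE k.
pose ub (k : I) := lossQ (l (tag k)) (Q (tag k)) (X k w).
pose vb (k : I) := risk (D (tag k)) (l (tag k)) (Q (tag k)).
have uE k : (\int[frakQ]_t (x k t (X k w))%:E = (ub k)%:E)%E.
  exact: (lossQ_frakQ hQ Q frakQ HQ (l (tag k)) (l_meas (tag k)) (l_01 (tag k)) (tag k) (X k w)).
have vE k : (\int[frakQ]_t (p k t)%:E = (vb k)%:E)%E.
  rewrite -(risk_frakQ hQ Q frakQ HQ (l (tag k)) (l_meas (tag k)) (l_01 (tag k)) (tag k)).
  by apply: eq_integral => t _; rewrite -pE.
have hRSE : \sum_k ub k = M%:R * hRS.
  rewrite (sumI (fun i j => lossQ (l i) (Q i) (z i j w))) /hRS mulr_sumr.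
  by apply: eq_bigr => i _; rewrite /emp_risk; field; rewrite Mn0 mn0.
have RSE : \sum_k vb k = M%:R * RS.
  rewrite (sumI (fun i _ => risk (D i) (l i) (Q i))) /RS mulr_sumr.
  apply: eq_bigr => i _; rewrite sumr_const card_ord -[LHS]mulr_natl.
  by field.
have mean01 (c : I -> R) y : (forall k, 0 <= c k <= 1) -> \sum_k c k = M%:R * y -> 0 <= y <= 1.
  move=> c01 cy; have -> : y = (\sum_k c k) / M%:R by rewrite cy mulrC mulKf.
  rewrite divr_ge0/=; last 2 first.
  - by apply: sumr_ge0 => k _; have /andP[] := c01 k.
  - exact: ltW.
  rewrite ler_pdivrMr// mul1r -cardI -sum1_card natr_sum.
  by apply: ler_sum => k _; have /andP[] := c01 k.
have ub01 k : 0 <= ub k <= 1.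
  have [y] := probability_mean01 frakQ _ (mX0 k) (fun t => x01 k t (X k w)).
  by rewrite uE => -[->].
have vb01 k : 0 <= vb k <= 1.
  have [y] := probability_mean01 frakQ _ (mp k) (p01 k).
  by rewrite vE => -[->].
have sumE a b c : \sum_k (a * ub k + b * vb k + c) = M%:R * (a * hRS + b * RS + c).
  rewrite !big_split/= -!mulr_sumr hRSE RSE sumr_const cardI -(mulr_natl c).
  by rewrite !mulrDr [a * _]mulrCA [b * _]mulrCA.
apply: kl_le_of_affine; first exact: mean01 ub01 hRSE.
  exact: mean01 vb01 RSE.
move=> r s r0 s0.
(* The coefficients of [x ln r + (1 - x) ln s + 1 - r p - s (1 - p)] as an affine function of
   [(x, p)]; summed over the samples it is the exponent controlled on [E], and its [frakQ]-mean is
   [M] times its value at [(hRS, RS)]. *)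
pose a := ln r - ln s; pose b := s - r; pose c := ln s + 1 - s.
pose h (t : T) := \sum_k (a * x k t (X k w) + b * p k t + c).
have hE t : h t = \sum_i (x i t (X i w) * ln r + (1 - x i t (X i w)) * ln s)
    + #|I|%:R * (1 - r * ((\sum_i p i t) / #|I|%:R) - s * (1 - (\sum_i p i t) / #|I|%:R)).
  rewrite cardI.
  have -> : M%:R * (1 - r * ((\sum_i p i t) / M%:R) - s * (1 - (\sum_i p i t) / M%:R))
     = \sum_(i : I) (1 - s) + \sum_i (s - r) * p i t.
    by rewrite sumr_const cardI -[(1 - s) *+ M]mulr_natl -mulr_sumr; field.
  by rewrite -!big_split /=; apply: eq_bigr => k _; rewrite /a /b /c; ring.
have mh := aff_measurable _ _ mX0 mp a b c.
have bh := aff_bounded _ _ (fun k t => x01 k t (X k w)) p01 a b c.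
have C0 : 0 < 2 * Num.sqrt M%:R / delta by rewrite divr_gt0// mulr_gt0// sqrtr_gt0.
have hC : (\int[frakP]_t (expR (h t))%:E <= (expR (ln (2 * Num.sqrt M%:R / delta)))%:E)%E.
  rewrite lnK ?posrE//; have := HE w Ew r s r0 s0; rewrite cardI.
  by under eq_integral do rewrite -cardI -hE.
have := Donsker_Varadhan R _ _ frakQ frakP h _ mh bh hC.
rewrite (integral_aff _ _ _ _ _ mX0 mp (fun k t => x01 k t (X k w)) p01 uE vE).
rewrite sumE => DV.
rewrite lee_pdivlMr//.
by apply: le_trans DV; rewrite -EFinM lee_fin /a /b /c; lra.
Qed.
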